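(* Let $P_0,P_1$ be probability measures on $(\mathcal X,\mathcal B_{\mathcal X})$ with $P_1\ll P_0$, $R=\frac{dP_1}{dP_0}$, $\mathrm{KL}(P_0\|P_1)<\infty$, $\mathrm{KL}(P_1\|P_0)<\infty$, and $\log R$ not $P_0$-a.s. constant. Let $\alpha\in(0,1)$, $\ell=\log\frac1\alpha$, and let $\kappa,\lambda,\mathcal B,\beta_{\max},R_\beta,B_t,\gamma_t$ be as in the context. Put $g(\beta):=\beta\kappa'(\beta)-\kappa(\beta)$ on $\mathcal B$. Then $g$ is strictly increasing on $\mathcal B$ with $g(0^+)=0$ and $g(1)=\mathrm{KL}(P_1\|P_0)$. For fixed $t\in\mathbb N$ the map $\beta\mapsto B_t(\beta)$ on $\mathcal B$ is strictly decreasing and then, if $\ell/t$ lies in the range of $g$, strictly increasing; in that case it has a unique minimiser $\beta^\ast(t)$, characterised by $g(\beta^\ast(t))=\ell/t$, and otherwise the infimum is approached as $\beta\uparrow\beta_{\max}$. The minimiser also minimises the type-II error $\gamma_t(\alpha)$ over the designs $R_\beta$, $\beta\in\mathcal B$. Moreover: (a) Whenever $\beta^\ast(t)$ exists, $\beta^\ast(t)>1$, $=1$, $<1$ according as $t<$, $=$, $>\ell/\mathrm{KL}(P_1\|P_0)$. In particular $R=R_1$ is the optimal member of the family at exactly the (generally non-integer) horizon $t=\ell/\mathrm{KL}(P_1\|P_0)$; below it $R$ is beaten (in $B_t$) by some $\beta>1$ and above it by some $\beta<1$, with $\beta^\ast(t)\downarrow0$ as $t\to\infty$. (b) Assume in addition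 that $\mathbb E_{P_0}[R^{-\delta}]<\infty$ for some $\delta>0$ and that $V_0:=\mathrm{Var}_{P_0}(\log R)\in(0,\infty)$ (which equals $\kappa''(0)$). Then $$\lambda(\beta)=\mathrm{KL}(P_0\|P_1)-\tfrac{V_0}2\beta+O(\beta^2)\ (\beta\downarrow0),\qquad\beta^\ast(t)=\sqrt{\frac{2\ell}{tV_0}}\,(1+o(1))\ (t\to\infty),$$ and the design $R_{\beta^\ast(t)}$ satisfies $$\gamma_t(\alpha)\le\exp\Big(-t\,\mathrm{KL}(P_0\|P_1)+\sqrt{2\ell tV_0}+O(1)\Big)\qquad(t\to\infty).$$
   Context: $Z_\beta:=\mathbb E_{P_0}[R^\beta]$, $\kappa(\beta):=\log Z_\beta$; $\mathcal B:=\{\beta>0:Z_\beta<\infty\}$, an interval containing $(0,1]$; $\beta_{\max}:=\sup\mathcal B\in[1,\infty]$. For $\beta\in\mathcal B$: $\lambda(\beta):=-\kappa(\beta)/\beta$, $R_\beta:=R^\beta/Z_\beta$, $B_t(\beta):=\frac\ell\beta-t\lambda(\beta)$. If $\beta_{\max}\in\mathcal B$, $\kappa'(\beta_{\max})$ denotes the left derivative. For the design $R_\beta$ in the i.i.d. model ($\Omega=\mathcal X^{\mathbb N}$, coordinates $X_n$, $\mathbb P_1=P_1^{\otimes\mathbb N}$) the wealth is $W_t=\prod_{n\le t}R_\beta(X_n)$ and $\gamma_t(\alpha):=\mathbb P_1(W_t\le\frac1\alpha)$.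
   Formalization: In (a), the claim that below t = ℓ/KL(P1‖P0) R is beaten by some β > 1 (so also that R is optimal at exactly this horizon) is stated under the extra hypothesis β_max > 1; if β_max = 1 there is no β > 1 in B and the claim fails. *)

(* Defs.v *)
From HB Require Import structures.
From mathcomp Require Import all_boot all_order all_algebra.
From mathcomp Require Import all_classical all_reals all_analysis.

Set Implicit Arguments.
Unset Strict Implicit.
Unset Printing Implicit Defensive.

Import Order.TTheory GRing.Theory Num.Theory.
Import numFieldNormedType.Exports.

Local Open Scope classical_set_scope.
Local Open Scope ring_scope.

Section LikelihoodRatio.
Context {d : measure_display} {X : measurableType d} {R : realType}.
Implicit Types P Q : probability X R.

Definition RNderiv P Q : X -> \bar R :=
  Radon_Nikodym (charge_of_finite_measure P) Q.

(* [lr] is a (real-valued, nonnegative) version of dP/dQ; versions agree only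
   up to Q-null sets *)
Definition is_RNderiv P Q (lr : X -> R) : Prop :=
  [/\ measurable_fun setT lr,
      forall x, 0 <= lr x &
      {ae Q, forall x, (lr x)%:E = RNderiv P Q x}].

(* the negative part of log(dP/dQ) is always P-integrable, so that the integral
   below is never of the form +oo - oo *)
Definition KL P Q : \bar R :=
  if pselect (P `<< Q) then (\int[P]_x lne (RNderiv P Q x))%E else +oo%E.

End LikelihoodRatio.

Section PowerFamily.
Context {d : measure_display} {X : measurableType d} {R : realType}.
Variables (P0 : probability X R) (lr : X -> R).

Definition Z (b : R) : \bar R := 'E_P0[fun x => ((lr x) `^ b)%R]%E.

(* meaningful for every real b, also negative, such that Z b is finite *)
Definition kappa (b : R) : R := ln (fine (Z b)).

Definition Bset : set R := [set b | 0 < b /\ (Z b < +oo)%E].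

Definition bmax : \bar R := ereal_sup (EFin @` Bset).

Definition lambda (b : R) : R := - kappa b / b.

Definition design (b : R) : X -> R := fun x => (lr x) `^ b / fine (Z b).

(* The derivative is extended-real-valued because the left derivative at bmax
   may be +oo when E[R^bmax log R] diverges. *)
Definition dquot (b x : R) : \bar R := ((kappa x - kappa b) / (x - b))%:E.

Definition dkappa (b : R) : \bar R :=
  if (b%:E < bmax)%E then (derive1 kappa b)%:E
  else lim (dquot b x @[x --> b^'-]).

Definition g (b : R) : \bar R := (b%:E * dkappa b - (kappa b)%:E)%E.

(* The horizon t is a real number, so that t = l / KL(P1 || P0) makes sense. *)
Definition Bt (l t b : R) : R := l / b - t * lambda b.

Definition in_range_g (y : R) : Prop := exists2 b, Bset b & g b = y%:E.

(* The optimal exponent at horizon t exists when l / t lies in the range of g.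
   When g(bmax) < l / t with bmax in Bset, the point bmax also minimises Bt, but
   it is not called optimal exponent. *)
Definition is_beta_star (l t b : R) : Prop :=
  [/\ in_range_g (l / t), Bset b &
      forall b', Bset b' -> b' != b -> Bt l t b < Bt l t b'].

Definition beta_star (l t : R) : R := xget 0 [set b | is_beta_star l t b].

End PowerFamily.

Section IIDModel.
Context {d : measure_display} {X : measurableType d} {R : realType}.

Definition cylinders : set (set (nat -> X)) :=
  [set C | exists n, exists2 A : set X, measurable A & C = [set w | A (w n)]].

Definition path_space := g_sigma_algebraType cylinders.

(* by the pi-lambda theorem this determines PP uniquely *)
Definition is_iid_law (P : probability X R) (PP : probability path_space R) :
    Prop :=
  forall (t : nat) (A : nat -> set X), (forall n, measurable (A n)) ->
    PP [set w : path_space | forall n, (n < t)%N -> A n (w n)] =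
    (\prod_(n < t) P (A n))%E.

Definition wealth (P0 : probability X R) (lr : X -> R) (b : R) (t : nat)
    (w : path_space) : R :=
  \prod_(n < t) design P0 lr b (w n).

Definition typeII (PP1 : probability path_space R) (P0 : probability X R)
    (lr : X -> R) (alpha b : R) (t : nat) : \bar R :=
  PP1 [set w | wealth P0 lr b t w <= alpha^-1].

End IIDModel.

(* Main.v *)
(* With [Y = ln lr], [kappa] is the cumulant generating function of [Y] under [P0]: it is strictly convex because [Y] is not constant, vanishes at 0 and 1, and is smooth below [bmax].  Up to the factor [t], [Bt t b] is the slope of the line through [(0, - l / t)] and [(b, kappa b)], so it is minimal exactly where this line is tangent to the graph of [kappa], i.e. where [g b = l / t], since [- g b] is the ordinate at 0 of the tangent at [b].  Strict convexity makes [g] strictly increasing, and [KL(P0 || P1)], [KL(P1 || P0)] are minus the slope of [kappa] at 0 and its left slope at 1, whence [g(0+) = 0] and [g 1 = KL(P1 || P0)].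

   The event defining the type-II error is [\prod lr(X_n) <= exp (Bt t b)], which is monotone in [Bt]; Markov's inequality for [\prod (1 / lr(X_n))], of expectation at most 1 under [P1], bounds its probability by [exp (Bt t b)].  The expansions at 0 come from [kappa' 0 = - KL(P0 || P1)] and [kappa'' 0 = V0] with a cubic remainder; evaluating [Bt] at [sqrt (2 l / (t V0))] gives the final bound. *)
Require Import Defs.
From HB Require Import structures.
From mathcomp Require Import all_boot all_order all_algebra.
From mathcomp Require Import all_classical all_reals all_analysis.
From mathcomp Require Import measurable_realfun.
From mathcomp Require Import ring lra.
Import Order.TTheory GRing.Theory Num.Theory.
Import numFieldNormedType.Exports.
Local Open Scope classical_set_scope.
Local Open Scope ring_scope.
Set Implicit Arguments.
Unset Strict Implicit.
Unset Printing Implicit Defensive.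

(** * Exponential moments *)

(** The difficulties sit at the ends of [Bset]. Strictly between 0 and [bmax] the moments can be
    differentiated under the integral, because finite moments on both sides dominate. But [bmax] may
    belong to [Bset], may equal 1, and may carry an infinite left slope, while at 0 no moment of
    negative order is assumed before the small-exponent expansions. The tangent slope is therefore
    taken as a supremum of chord slopes in [\bar R], which convexity makes meaningful on all of
    [Bset]; Jensen's inequality replaces differentiation at 0; at 1 a dominated convergence argument
    uses exactly the integrability given by a finite KL(P1 || P0); and inequalities reach [bmax] by
    left continuity. Zeros of [lr] are the other obstacle. A finite KL(P0 || P1) forces [P0] to be
    absolutely continuous with respect to [P1], so [lr] is positive [P0]-almost everywhere and [Z]
    becomes an exponential moment of [ln lr]. *)

Lemma exprn_expR_le (R : realType) (k : nat) (a u v c : R) : a < u -> v < c ->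
  exists2 C : R, 0 <= C & forall x y : R, u <= x -> x <= v ->
    `|y| ^+ k * expR (x * y) <= C * (expR (a * y) + expR (c * y)).
Proof.
move=> au vc.
pose e := Num.min (u - a) (c - v).
have e0 : 0 < e by rewrite lt_min !subr_gt0 au vc.
have ea : e <= u - a by rewrite ge_min lexx.
have ec : e <= c - v by rewrite ge_min lexx orbT.
have k0 : 0 < (k.+1%:R : R) by rewrite ltr0n.
exists ((k.+1%:R / e) ^+ k) => [|x y ux xv]; first by rewrite exprn_ge0// divr_ge0// ltW.
(* The [k]-th power of [z <= expR z] at [z = e * |y| / (k + 1)]; dividing by [k + 1] rather than [k]
   keeps [k = 0] legal. The margin [e] is then absorbed by moving from [x] to [a] or [c], according
   to the sign of [y]. *)
have pow_le : `|y| ^+ k <= (k.+1%:R / e) ^+ k * expR (e * `|y|).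
  have -> : `|y| = (k.+1%:R / e) * (e * `|y| / k.+1%:R).
    by field; rewrite (gt_eqF e0) gt_eqF//= addrC natr1.
  rewrite {1}exprMn ler_pM2l; last by rewrite exprn_gt0// divr_gt0.
  have -> : e * (k.+1%:R / e * (e * `|y| / k.+1%:R)) = k.+1%:R * (e * `|y| / k.+1%:R).
    by field; rewrite (gt_eqF e0) gt_eqF//= addrC natr1.
  set z := e * `|y| / k.+1%:R.
  have z0 : 0 <= z by rewrite divr_ge0 ?mulr_ge0// ltW.
  rewrite (@le_trans _ _ (expR z ^+ k))//.
    apply: lerXn2r; rewrite ?nnegrE ?expR_ge0//.
    by apply: le_trans (expR_ge1Dx z); rewrite lerDr.
  by rewrite -expRM_natl ler_expR ler_wpM2r// ler_nat.
apply: (@le_trans _ _ ((k.+1%:R / e) ^+ k * (expR (e * `|y|) * expR (x * y)))).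
  by rewrite mulrA ler_wpM2r// expR_ge0.
rewrite ler_wpM2l//; first by rewrite exprn_ge0// divr_ge0// ltW.
rewrite -expRD.
have [y0|y0] := leP 0 y.
  rewrite ger0_norm// -mulrDl (le_trans (y := expR (c * y)))//.
    by rewrite ler_expR ler_wpM2r//; lra.
  by rewrite lerDr expR_ge0.
rewrite ltr0_norm// (le_trans (y := expR (a * y)))//; last by rewrite lerDl expR_ge0.
by rewrite ler_expR; nra.
Qed.

(** Once [expR w] at the barycentre [w] is factored out, the gap is a convex combination of terms
    [expR h - (1 + h)], which are nonnegative and vanish only at [h = 0]. *)
Lemma expR_strictly_convex (R : realType) (t u v : R) : 0 < t -> t < 1 ->
  expR (t * u + (1 - t) * v) <= t * expR u + (1 - t) * expR v ?= iff (u == v).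
Proof.
move=> t0 t1'; have t1 : 0 < 1 - t by rewrite subr_gt0.
set w := t * u + (1 - t) * v.
have hu : expR u = expR w * expR (u - w) by rewrite -expRD; congr expR; ring.
have hv : expR v = expR w * expR (v - w) by rewrite -expRD; congr expR; ring.
have w0 := expR_gt0 w.
have tw : t * (u - w) + (1 - t) * (v - w) = 0 by rewrite /w; ring.
have e : t * expR u + (1 - t) * expR v - expR w =
    expR w * (t * (expR (u - w) - (1 + (u - w))) + (1 - t) * (expR (v - w) - (1 + (v - w)))).
  have -> : expR w * (t * (expR (u - w) - (1 + (u - w))) + (1 - t) * (expR (v - w) - (1 + (v - w)))) =
    t * (expR w * expR (u - w)) + (1 - t) * (expR w * expR (v - w)) - expR w
    - expR w * (t * (u - w) + (1 - t) * (v - w)) by ring.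
  by rewrite tw mulr0 subr0 -hu -hv.
have gu : 0 <= expR (u - w) - (1 + (u - w)) by rewrite subr_ge0 expR_ge1Dx.
have gv : 0 <= expR (v - w) - (1 + (v - w)) by rewrite subr_ge0 expR_ge1Dx.
apply/leifP; case: eqVneq => [uv|uv].
  rewrite /w uv -!mulrDl addrC subrK !mul1r; apply/eqP.
  by congr expR; rewrite -mulrDl addrC subrK mul1r.
rewrite -subr_gt0 e pmulr_rgt0// lt_neqAle addr_ge0 ?mulr_ge0// ?ltW// andbT.
apply: contra_neqN uv => /eqP/esym/eqP; rewrite paddr_eq0 ?mulr_ge0// ?ltW//.
rewrite mulf_eq0 [(1 - t) * _ == 0]mulf_eq0 (gt_eqF t0) (gt_eqF t1)/= => /andP[hu0 hv0].
have z (x : R) : expR x - (1 + x) == 0 -> x = 0.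
  move=> /eqP x0; apply/eqP; apply: contraT => /expR_gt1Dx.
  by rewrite -subr_gt0 x0 ltxx.
by move/z/eqP: hu0; move/z/eqP: hv0; rewrite !subr_eq0 => /eqP -> /eqP ->.
Qed.

Lemma is_derive_expRMr (R : realType) (x y : R) :
  is_derive x 1 (fun b => expR (b * y)) (y * expR (x * y)).
Proof.
have h : is_derive x 1 (fun b : R => b * y) y.
  by apply: is_derive_eq; rewrite scaler0 add0r /GRing.scale/= mulr1.
have := @is_derive1_comp _ (@expR R) (fun b : R => b * y) x _ _ (is_derive_expR _) h.
by move/is_derive_eq; apply; rewrite mulrC.
Qed.

Lemma Rintegral_gt0 d (T : measurableType d) (R : realType)
    (P : probability T R) (f : T -> R) :
  P.-integrable setT (EFin \o f) -> (forall x, 0 <= f x) ->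
  ~ {ae P, forall x, f x = 0} -> 0 < \int[P]_x f x.
Proof.
move=> fi f0 nf; rewrite lt_neqAle Rintegral_ge0 ?andbT//.
apply/eqP => /esym h0; apply: nf.
have h2 : (\int[P]_x `|(EFin \o f) x| = 0)%E.
  rewrite -[RHS]/(0%:E) -h0 /Rintegral fineK ?integrable_fin_num//.
  by apply: eq_integral => x _; rewrite gee0_abs// lee_fin.
have /(ae_eq_integral_abs P measurableT) := h2.
move=> /(_ (measurable_int _ fi)).
by apply: filterS => x /(_ I) [].
Qed.

Lemma ae_probability_false d (T : measurableType d) (R : realType)
    (P : probability T R) : ~ {ae P, forall x : T, False}.
Proof.
move=> [N [mN N0 subN]].
have : P setT = 0%E.
  rewrite -N0; congr (P _); apply/seteqP; split=> // x _.
  by apply: subN => /=.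
by rewrite probability_setT => /eqP; rewrite onee_eq0.
Qed.

(** * Regularity and convexity of the moments of a random variable *)

Section moment_generating.
Context d (T : measurableType d) (R : realType) (P : probability T R).
Variable Y : T -> R.
Hypothesis mY : measurable_fun setT Y.

Definition has_expmom (b : R) :=
  P.-integrable setT (EFin \o (fun x => expR (b * Y x))).

Definition expmom (k : nat) (b : R) : R :=
  \int[P]_x (Y x ^+ k * expR (b * Y x)).

Lemma measurable_expmom k b :
  measurable_fun setT (fun x => Y x ^+ k * expR (b * Y x)).
Proof.
apply: measurable_funM; first exact: measurable_funX.
by apply: measurableT_comp => //; exact: measurable_funM.
Qed.

Lemma measurable_expRM b : measurable_fun setT (fun x => expR (b * Y x)).
Proof. by apply: measurableT_comp => //; exact: measurable_funM. Qed.

Lemma has_expmom0 : has_expmom 0.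
Proof.
rewrite /has_expmom (_ : _ \o _ = cst 1%:E); last first.
  by apply/funext => x /=; rewrite mul0r expR0.
exact: finite_measure_integrable_cst.
Qed.

(** One integrable bound serves all exponents of [[u, v]], as differentiation under the integral
    requires. *)
Lemma has_expmom_le_integrable k a u v c : a < u -> v < c ->
  has_expmom a -> has_expmom c -> exists2 G : T -> R,
    P.-integrable setT (EFin \o G) & forall x y, u <= x -> x <= v ->
      `|Y y ^+ k * expR (x * Y y)| <= G y.
Proof.
move=> au vc ha hc; have [C C0 HC] := exprn_expR_le k au vc.
exists (fun y => C * (expR (a * Y y) + expR (c * Y y))) => [|x y ux xv].
  rewrite (_ : _ \o _ = (fun x => C%:E * ((EFin \o (fun x => expR (a * Y x))) \+
     (EFin \o (fun x => expR (c * Y x)))) x)%E)//.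
  by apply: integrableZl => //; exact: integrableD.
by rewrite normrM normrX (ger0_norm (expR_ge0 _)); exact: HC.
Qed.

Lemma has_expmom_itv a b c : a <= b -> b <= c ->
  has_expmom a -> has_expmom c -> has_expmom b.
Proof.
move=> ab bc ha hc; apply: (le_integrable measurableT _ _
  (integrableD measurableT ha hc)).
  exact/measurable_EFinP/measurable_expRM.
move=> x _ /=; rewrite lee_fin !ger0_norm ?addr_ge0 ?expR_ge0//.
have [y0|/ltW y0] := leP 0 (Y x).
  rewrite (le_trans (y := expR (c * Y x)))// ?lerDr ?expR_ge0//.
  by rewrite ler_expR ler_wpM2r.
rewrite (le_trans (y := expR (a * Y x)))// ?lerDl ?expR_ge0//.
by rewrite ler_expR ler_wnM2r.
Qed.

Lemma expmom_integrable k a b c : a < b -> b < c ->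
  has_expmom a -> has_expmom c ->
  P.-integrable setT (EFin \o (fun x => Y x ^+ k * expR (b * Y x))).
Proof.
move=> ab bc ha hc.
have [G iG HG] := has_expmom_le_integrable k ab bc ha hc.
apply: (le_integrable measurableT _ _ iG).
  exact/measurable_EFinP/measurable_expmom.
move=> x _ /=; rewrite lee_fin (le_trans (HG b x _ _))//.
exact: ler_norm.
Qed.

Lemma is_derive_expmom k a b c : a < b -> b < c ->
  has_expmom a -> has_expmom c ->
  is_derive b 1 (expmom k) (expmom k.+1 b).
Proof.
move=> ab bc ha hc.
(* Midpoints leave room on both sides: [b] is interior to [[u, v]], and [a], [c] lie strictly
   outside it. *)
pose u := (a + b) / 2; pose v := (b + c) / 2.
have [au ub bv vc] : [/\ a < u, u < b, b < v & v < c].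
  by rewrite /u /v; split; lra.
have [G iG HG] := has_expmom_le_integrable k.+1 au vc ha hc.
pose f x y := Y y ^+ k * expR (x * Y y).
have df (x : R) (y : T) : is_derive x 1 (f ^~ y) (Y y ^+ k.+1 * expR (x * Y y)).
  have h := is_derive_expRMr x (Y y).
  rewrite /f exprSr -mulrA; exact: is_deriveZ.
have bI : `]u, v[%classic b by rewrite /= in_itv /= ub bv.
have itf x : `]u, v[%classic x -> P.-integrable setT (EFin \o f x).
  rewrite /= in_itv/= => /andP[ux xv].
  by apply: (@expmom_integrable _ a _ c) => //; [exact: lt_trans ux|exact: lt_trans vc].
have df1 x y : `]u, v[%classic x -> setT y -> derivable (f ^~ y) x 1.
  by move=> _ _; have [] := df x y.
have d1 x y : partial1of2 f x y = Y y ^+ k.+1 * expR (x * Y y).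
  by rewrite partial1of2E; apply: derive_val.
have G0 y : 0 <= G y.
  exact: le_trans (HG b y (ltW ub) (ltW bv)).
have Gub x y : `]u, v[%classic x -> setT y -> `|partial1of2 f x y| <= G y.
  rewrite /= in_itv/= => /andP[ux xv] _; rewrite d1.
  by apply: HG; exact: ltW.
have H1 := derivable_under_integral measurableT bI itf df1 G0 iG Gub.
have H2 := differentiation_under_integral measurableT bI itf df1 G0 iG Gub.
apply: DeriveDef; first exact: H1.
rewrite -derive1E H2 /expmom; apply: eq_Rintegral => y _.
exact: d1.
Qed.

Lemma expmom0E b : expmom 0 b = \int[P]_x expR (b * Y x).
Proof. by apply: eq_Rintegral => x _; rewrite expr0 mul1r. Qed.

Lemma expmom1E b : expmom 1 b = \int[P]_x (Y x * expR (b * Y x)).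
Proof. by apply: eq_Rintegral => x _; rewrite expr1. Qed.

Lemma expmom00 : expmom 0 0 = 1.
Proof.
rewrite expmom0E (_ : (fun x => _) = cst 1); last first.
  by apply/funext => x; rewrite mul0r expR0.
by rewrite Rintegral_cst//= probability_setT mulr1.
Qed.

(* Unification would otherwise unfold integrals when comparing moments. *)
Opaque expmom.

Lemma expmom0_gt0 b : has_expmom b -> 0 < expmom 0 b.
Proof.
move=> hb; rewrite expmom0E; apply: Rintegral_gt0 => // h.
apply: (@ae_probability_false _ _ _ P); apply: filterS h => x /eqP.
by rewrite gt_eqF// expR_gt0.
Qed.

(** Strict Hölder inequality, proved pointwise. With the exponentials at [a] and [c] normalised to
    integral 1, convexity of [expR] makes [f] nonnegative, and its integral is
    [1 - expR (B - t * A - (1 - t) * C)]. *)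
Let log_convex_aux a b c A B C :
  ~ (exists r : R, {ae P, forall x, Y x = r}) ->
  has_expmom a -> has_expmom c -> a < b -> b < c ->
  expmom 0 a = expR A -> expmom 0 b = expR B -> expmom 0 c = expR C ->
  (c - a) * B < (c - b) * A + (b - a) * C.
Proof.
move=> nc ha hc ab bc eA eB eC.
have hb : has_expmom b by apply: (@has_expmom_itv a b c) => //; exact: ltW.
have ca : 0 < c - a by rewrite subr_gt0 (lt_trans ab).
have ca0 : c - a != 0 by rewrite gt_eqF.
pose t := (c - b) / (c - a).
have t0 : 0 < t by rewrite divr_gt0// subr_gt0.
have t1 : 0 < 1 - t.
  have -> : 1 - t = (b - a) / (c - a) by rewrite /t; field.
  by rewrite divr_gt0// subr_gt0.
have t1' : t < 1 by rewrite -subr_gt0.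
have bE : b = t * a + (1 - t) * c by rewrite /t; field.
pose f x := t * expR (- A) * expR (a * Y x) + (1 - t) * expR (- C) * expR (c * Y x)
  - expR (- (t * A + (1 - t) * C)) * expR (b * Y x).
have fE x : f x = t * expR (a * Y x - A) + (1 - t) * expR (c * Y x - C)
    - expR (t * (a * Y x - A) + (1 - t) * (c * Y x - C)).
  have -> : t * (a * Y x - A) + (1 - t) * (c * Y x - C) =
      - (t * A + (1 - t) * C) + b * Y x by rewrite bE; ring.
  by rewrite /f !(expRD (_ * Y x)) (expRD _ (_ * Y x)); ring.
have iZ (r s : R) : has_expmom s ->
    P.-integrable setT (EFin \o (fun x => r * expR (s * Y x))).
  by move=> hs; apply: (integrableZl measurableT r hs).
have iD : P.-integrable setT (EFin \o (fun x => t * expR (- A) * expR (a * Y x)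
    + (1 - t) * expR (- C) * expR (c * Y x))).
  exact: (integrableD measurableT (iZ _ _ ha) (iZ _ _ hc)).
have fi : P.-integrable setT (EFin \o f).
  exact: (integrableB measurableT iD (iZ _ _ hb)).
have : 0 < \int[P]_x f x.
  apply: Rintegral_gt0 => // [x|f0].
    by rewrite fE subr_ge0; exact: (expR_strictly_convex _ _ t0 t1').1.
  (* Equality in the convexity of [expR] forces [a * Y - A = c * Y - C], which determines [Y]. *)
  apply: nc; exists ((C - A) / (c - a)); apply: filterS f0 => x.
  rewrite fE => /eqP; rewrite subr_eq0 eq_sym (expR_strictly_convex _ _ t0 t1').2 => /eqP h.
  have -> : C - A = Y x * (c - a).
    rewrite -[LHS]addr0 -(subrr (a * Y x - A)) {1}h; ring.
  by rewrite mulfK.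
rewrite RintegralB//; last exact: iZ.
rewrite RintegralD//; try exact: iZ.
rewrite !RintegralZl// -!expmom0E eA eB eC.
have kA : expR (- A) * expR A = 1 by rewrite -expRD addNr expR0.
have kC : expR (- C) * expR C = 1 by rewrite -expRD addNr expR0.
rewrite -(mulrA t) -(mulrA (1 - t)) kA kC !mulr1 [t + _]addrC subrK subr_gt0.
rewrite -expRD -[X in _ < X -> _](expR0) ltr_expR => h.
have -> : (c - b) = t * (c - a) by rewrite /t divfK.
have -> : (b - a) = (1 - t) * (c - a) by rewrite /t; field.
rewrite -subr_gt0 (_ : _ - _ = (c - a) * (- (- (t * A + (1 - t) * C) + B))); last by ring.
by rewrite mulr_gt0// oppr_gt0.
Qed.

Lemma ln_expmom_strictly_convex a b c :
  ~ (exists r : R, {ae P, forall x, Y x = r}) ->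
  has_expmom a -> has_expmom c -> a < b -> b < c ->
  (c - a) * ln (expmom 0 b) < (c - b) * ln (expmom 0 a) + (b - a) * ln (expmom 0 c).
Proof.
move=> nc ha hc ab bc.
have hb : has_expmom b := has_expmom_itv (ltW ab) (ltW bc) ha hc.
by apply: log_convex_aux => //; rewrite lnK// posrE; exact: expmom0_gt0.
Qed.

(* Jensen's inequality for [expR] under the law tilted by [expR (b * Y)]. *)
Lemma ln_expmom_tangent b c :
  P.-integrable setT (EFin \o (fun x => Y x * expR (b * Y x))) ->
  has_expmom b -> has_expmom c ->
  ln (expmom 0 b) + expmom 1 b / expmom 0 b * (c - b) <= ln (expmom 0 c).
Proof.
move=> i1 hb hc; have Zb := expmom0_gt0 hb; have Zc := expmom0_gt0 hc.
have [m em] : exists m, m = expmom 1 b / expmom 0 b by eexists.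
rewrite -em.
have iL : P.-integrable setT (EFin \o (fun x => (1 - (c - b) * m) * expR (b * Y x)
    + (c - b) * (Y x * expR (b * Y x)))).
  exact: (integrableD measurableT (integrableZl measurableT (1 - (c - b) * m) hb)
    (integrableZl measurableT (c - b) i1)).
have iR : P.-integrable setT (EFin \o (fun x => expR (- (m * (c - b))) * expR (c * Y x))).
  exact: (integrableZl measurableT _ hc).
have : \int[P]_x ((1 - (c - b) * m) * expR (b * Y x) + (c - b) * (Y x * expR (b * Y x)))
    <= \int[P]_x (expR (- (m * (c - b))) * expR (c * Y x)).
  apply: le_Rintegral => // x _; rewrite -expRD.
  have -> : - (m * (c - b)) + c * Y x = b * Y x + (c - b) * (Y x - m) by ring.
  rewrite expRD.
  have -> : (1 - (c - b) * m) * expR (b * Y x) + (c - b) * (Y x * expR (b * Y x)) =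
    expR (b * Y x) * (1 + (c - b) * (Y x - m)) by ring.
  by rewrite ler_pM2l ?expR_gt0// expR_ge1Dx.
rewrite RintegralZl// -expmom0E RintegralD//; last 2 first.
  exact: (integrableZl measurableT _ hb).
  exact: (integrableZl measurableT _ i1).
rewrite !RintegralZl// -expmom0E -expmom1E.
have -> : (1 - (c - b) * m) * expmom 0 b + (c - b) * expmom 1 b = expmom 0 b.
  rewrite em; field; exact: lt0r_neq0.
rewrite -[X in X <= _ -> _]lnK// -[X in _ <= _ * X -> _]lnK// -expRD ler_expR.
by rewrite addrC -lerBlDr opprK addrC.
Qed.

(** The exponents stay in [[0, b]], so [1 + expR (b * Y)] dominates without any moment beyond [b].
    This yields left continuity even at [bmax]. *)
Lemma expmom0_cvg (b : R) (u : R^nat) : 0 <= b -> has_expmom b ->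
  (forall n, 0 <= u n <= b) -> u n @[n --> \oo] --> b ->
  expmom 0 (u n) @[n --> \oo] --> expmom 0 b.
Proof.
move=> b0 hb ub cu.
pose G x := 1 + expR (b * Y x).
have iG : P.-integrable setT (EFin \o G).
  apply: (@integrableD _ _ _ P _ measurableT (EFin \o cst 1) (EFin \o (fun x => expR (b * Y x)))) => //.
  exact: finite_measure_integrable_cst.
have [] := @dominated_convergence _ _ _ P setT measurableT
  (fun n x => (expR (u n * Y x))%:E) (fun x => (expR (b * Y x))%:E) (EFin \o G).
- by move=> n; apply/measurable_EFinP; exact: measurable_expRM.
- by apply/measurable_EFinP; exact: measurable_expRM.
- apply/aeW => x _; apply: cvg_EFin; first exact: nearW.
  apply: continuous_cvg; first exact: continuous_expR.
  by apply: cvgMr_tmp cu.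
- exact: iG.
- apply/aeW => x n _ /=; rewrite lee_fin ger0_norm ?expR_ge0// /G.
  have /andP[u0 unb] := ub n.
  have [y0|/ltW y0] := leP 0 (Y x).
    rewrite (@le_trans _ _ (expR (b * Y x)))// ?lerDr//.
    by rewrite ler_expR ler_wpM2r.
  rewrite (@le_trans _ _ 1)// ?lerDl ?expR_ge0//.
  by rewrite -expR0 ler_expR mulr_ge0_le0.
move=> _ _ H; rewrite expmom0E; under eq_cvg do rewrite expmom0E.
by apply: fine_cvg; rewrite fineK ?integrable_fin_num.
Qed.

(** Left difference quotient of the moment at 1. Since 1 may be the largest admissible exponent,
    domination has to come from [Y * expR Y] itself instead of a higher moment. *)
Lemma expmom0_slope1_cvg (u : R^nat) : has_expmom 1 ->
  P.-integrable setT (EFin \o (fun x => Y x * expR (Y x))) ->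
  (forall n, 0 <= u n < 1) -> u n @[n --> \oo] --> (1 : R) ->
  (expmom 0 1 - expmom 0 (u n)) / (1 - u n) @[n --> \oo] -->
    \int[P]_x (Y x * expR (Y x)).
Proof.
move=> h1 iYe ub cu.
have hu n : has_expmom (u n).
  have /andP[u0 /ltW u1] := ub n.
  by apply: (has_expmom_itv u0 u1) => //; exact: has_expmom0.
pose q n x := (1 - u n)^-1 * (expR (1 * Y x) - expR (u n * Y x)).
pose G x := `|Y x * expR (Y x)| + (1 + expR (1 * Y x)).
have mq n : measurable_fun setT (q n).
  apply: measurable_funM => //; apply: measurable_funB; exact: measurable_expRM.
have iB n : P.-integrable setT (EFin \o (fun x => expR (1 * Y x) - expR (u n * Y x))).
  exact: (integrableB measurableT h1 (hu n)).
have iG : P.-integrable setT (EFin \o G).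
  have i1 : P.-integrable setT (EFin \o (fun x => `|Y x * expR (Y x)|)).
    exact: (integrable_norm iYe).
  have i2 : P.-integrable setT (EFin \o cst (1 : R)).
    exact: finite_measure_integrable_cst.
  exact: (integrableD measurableT i1 (integrableD measurableT i2 h1)).
have [] := @dominated_convergence _ _ _ P setT measurableT
  (fun n x => (q n x)%:E) (fun x => (Y x * expR (Y x))%:E) (EFin \o G).
- by move=> n; exact/measurable_EFinP.
- exact: measurable_int iYe.
- apply/aeW => x _; apply: cvg_EFin; first exact: nearW.
  have [dd dv] := is_derive_expRMr 1 (Y x).
  have dl : (h : R)^-1 * (expR ((h * 1 + 1) * Y x) - expR (1 * Y x)) @[h --> (0 : R)^'] -->
      ('D_1 (fun b : R => expR (b * Y x)) (1 : R) : R) := dd.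
  rewrite dv mul1r in dl.
  have /cvgr_dnbhsP := dl.
  move=> /(_ (fun n => u n - 1)) H.
  have : (forall n, u n - 1 != 0) /\ u n - 1 @[n --> \oo] --> (0 : R).
    split; first by move=> n; have /andP[_ un] := ub n; rewrite subr_eq0 lt_eqF.
    by rewrite -(subrr (1 : R)); apply: cvgB => //; exact: cvg_cst.
  move=> /H; apply: cvg_trans; apply: near_eq_cvg; apply: nearW => n /=.
  rewrite /q /GRing.scale/= mulr1 subrK -(opprB 1 (u n)) invrN mulNr -mulrN opprB.
  by rewrite mul1r.
- exact: iG.
- apply/aeW => x n _ /=; rewrite lee_fin /G /q mul1r.
  have /andP[u0 u1] := ub n.
  have u1' : 0 < 1 - u n by rewrite subr_gt0.
  rewrite normrM gtr0_norm ?invr_gt0// mulrC ler_pdivrMr//.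
  set y := Y x; set v := u n.
  (* The tangent at [y] bounds the quotient above by [y * expR y], and convexity between exponents 0
     and 1 bounds it below by [expR y - 1]; both are controlled by [G]. *)
  have e1 : expR (v * y) >= expR y * (1 + (v - 1) * y).
    rewrite (_ : v * y = y + (v - 1) * y); last by ring.
    by rewrite expRD ler_pM2l ?expR_gt0// expR_ge1Dx.
  have e2 : expR (v * y) <= v * expR y + (1 - v).
    have h1' : expR y >= expR (v * y) * (1 + (1 - v) * y).
      have -> : expR y = expR (v * y + (1 - v) * y) by congr expR; ring.
      by rewrite expRD ler_pM2l ?expR_gt0// expR_ge1Dx.
    have h2' : 1 >= expR (v * y) * (1 - v * y).
      suff : expR (v * y) * (1 + - (v * y)) <= expR (v * y + - (v * y)).
        by rewrite subrr expR0.
      by rewrite expRD ler_pM2l ?expR_gt0// expR_ge1Dx.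
    have := ler_wpM2l u0 h1'; have := ler_wpM2l (ltW u1') h2'.
    by rewrite -/v; lra.
  have a0 : `|y * expR y| >= y * expR y by exact: ler_norm.
  have a1 : `|y * expR y| * (1 - v) >= y * expR y * (1 - v) by rewrite ler_wpM2r// ltW.
  have a2 : 0 <= `|y * expR y| * (1 - v) by rewrite mulr_ge0// ltW.
  have a3 : 0 <= expR y * (1 - v) by rewrite mulr_ge0 ?expR_ge0// ltW.
  have a4 : 0 < 1 - v by [].
  by rewrite ler_norml; apply/andP; split; lra.
move=> _ _ H.
have qE n : (expmom 0 1 - expmom 0 (u n)) / (1 - u n) = \int[P]_x q n x.
  rewrite mulrC !expmom0E -RintegralB//; last exact: hu.
  by rewrite -RintegralZl//; exact: iB.
under eq_cvg do rewrite qE.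
by apply: fine_cvg; rewrite fineK ?integrable_fin_num.
Qed.

End moment_generating.

(** * The likelihood ratio *)

(* The lower bound makes the negative part integrable, so a finite integral forces the positive part to be integrable too. *)
Lemma integrable_lower_bound d (T : measurableType d) (R : realType)
    (P : {measure set T -> \bar R}) (f g : T -> R) :
  measurable_fun setT f -> P.-integrable setT (EFin \o g) ->
  (forall x, 0 <= g x) -> (forall x, - g x <= f x) ->
  (\int[P]_x (f x)%:E < +oo)%E -> P.-integrable setT (EFin \o f).
Proof.
move=> mf ig g0 gf fy.
have mEf : measurable_fun setT (EFin \o f) by exact/measurable_EFinP.
have nfin : (\int[P]_x ((EFin \o f)^\- x) < +oo)%E.
  have/integrableP[mg] := ig; apply: le_lt_trans.
  apply: ge0_le_integral => //.
  - exact: measurable_funeneg.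
  - exact: measurableT_comp.
  - move=> x _ /=; rewrite funenegE /= -EFin_max lee_fin.
    by rewrite ger0_norm// ge_max g0 andbT lerNl.
apply/integrableP; split=> //.
rewrite -[X in (integral _ _ X < _)%E]/(abse \o (EFin \o f)) fune_abse ge0_integralD//; last 2 first.
  exact: measurable_funepos.
  exact: measurable_funeneg.
apply: lte_add_pinfty => //.
rewrite ltNge leye_eq; apply/eqP => py.
move: fy; rewrite integralE.
rewrite -[X in (\int[P]_x X x - _)%E]/((EFin \o f)^\+)%E py.
by rewrite addye ?ltxx// eqe_oppLR lt_eqF.
Qed.

Lemma measurable_lne_EFin d (T : measurableType d) (R : realType) (f : T -> \bar R) :
  (forall x, f x \is a fin_num) -> measurable_fun setT f ->
  measurable_fun setT (fun x => lne (f x)).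
Proof.
move=> ff mf.
rewrite (_ : (fun x => _) = (fun x => if fine (f x) <= 0 then -oo%E else (ln (fine (f x)))%:E)).
  have mff : measurable_fun setT (fun x => fine (f x)).
    apply/measurable_EFinP; rewrite (_ : _ \o _ = f)//.
    by apply/funext => x /=; rewrite fineK.
  apply: measurable_fun_ifT => //.
  - exact: measurable_fun_ler.
  - by apply/measurable_EFinP; apply: (measurableT_comp (@measurable_ln R)).
by apply/funext => x; rewrite -{1}(fineK (ff x)).
Qed.

Section likelihood_ratio.
Context d (X : measurableType d) (R : realType) (P0 P1 : probability X R).
Variable lr : X -> R.
Hypotheses (P1_ll_P0 : P1 `<< P0) (lrP : is_RNderiv P1 P0 lr)
  (KL01_fin : (KL P0 P1 < +oo)%E) (KL10_fin : (KL P1 P0 < +oo)%E).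

Local Notation Y := (fun x => ln (lr x)).

Lemma P0_ll_P1 : P0 `<< P1.
Proof. by move: KL01_fin; rewrite /KL; case: pselect => // _; rewrite ltxx. Qed.

Lemma measurable_lr : measurable_fun setT lr.
Proof. by case: lrP. Qed.

Lemma measurable_ln_lr : measurable_fun setT Y.
Proof. by apply: measurableT_comp => //; exact: measurable_lr. Qed.

Lemma RNderiv10_ae : {ae P0, forall x, RNderiv P1 P0 x = (lr x)%:E}.
Proof. by case: lrP => _ _; apply: filterS => x ->. Qed.

(** The chain rule gives [dP0/dP1 * dP1/dP0 = dP0/dP0 = 1] almost everywhere under [P0], so neither
    factor can vanish. *)
Lemma RNderiv01_ae : {ae P0, forall x, 0 < lr x /\ RNderiv P0 P1 x = ((lr x)^-1)%:E}.
Proof.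
have H := Radon_Nikodym_chain_rule (nu := charge_of_finite_measure P0) (la := P0) (mu := P1).
have {}H := H P0_ll_P1 P1_ll_P0.
have H1 : ae_eq P0 setT (Radon_Nikodym (charge_of_finite_measure P0) P0) (cst 1%E).
  apply: integral_ae_eq => //.
  - exact: Radon_Nikodym_integrable.
  - move=> E _ mE; rewrite -Radon_Nikodym_integral// integral_cst// mul1e.
    by [].
case: lrP => _ lr0 H2.
apply: filterS3 H H1 H2 => x /(_ I) -> /(_ I) /= h1 h2.
have /fineK r01 := @Radon_Nikodym_fin_num _ _ _ (charge_of_finite_measure P0) P1 x P0_ll_P1.
move: h1; rewrite -/(RNderiv P1 P0 x) -h2 /RNderiv -r01 -EFinM => -[] h.
have lrx : lr x != 0.
  by apply/eqP => lrx0; move: h; rewrite lrx0 mulr0 => /esym/eqP; rewrite oner_eq0.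
split; first by rewrite lt_neqAle eq_sym lrx lr0.
by congr EFin; rewrite -[LHS]mulr1 -(mulfV lrx) mulrA h mul1r.
Qed.

Lemma lr_gt0_ae : {ae P0, forall x, 0 < lr x}.
Proof. by apply: filterS RNderiv01_ae => x []. Qed.

(** Where [lr x = 0] and [b] is nonzero the two sides disagree: the power is 0, while [ln 0 = 0]
    makes the exponential 1. *)
Lemma expR_ln_lr_ae b : {ae P0, forall x, lr x `^ b = expR (b * ln (lr x))}.
Proof. by have H := lr_gt0_ae; apply: filterS H => x x0; rewrite /powR gt_eqF. Qed.

Lemma Z_expR b : Z P0 lr b = (\int[P0]_x (expR (b * ln (lr x)))%:E)%E.
Proof.
rewrite /Z unlock; apply: ge0_ae_eq_integral => //.
- apply/measurable_EFinP; apply: (measurableT_comp (measurable_powR b)).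
  exact: measurable_lr.
- by apply/measurable_EFinP; exact: (measurable_expRM measurable_ln_lr).
- by move=> x _; rewrite lee_fin powR_ge0.
- by have H := expR_ln_lr_ae b; apply: filterS H => x /= -> _.
Qed.

Lemma Z_has_expmom b : (Z P0 lr b < +oo)%E <-> has_expmom P0 Y b.
Proof.
have mE : measurable_fun setT (EFin \o (fun x => expR (b * ln (lr x)))).
  exact/measurable_EFinP/(measurable_expRM measurable_ln_lr).
have e : Z P0 lr b = (\int[P0]_x `|(EFin \o (fun x => expR (b * ln (lr x)))) x|)%E.
  rewrite Z_expR; apply: eq_integral => x _ /=.
  by rewrite ger0_norm// expR_ge0.
by rewrite e; split => [h|/integrableP[]//]; apply/integrableP.
Qed.

Lemma Z_expmom b : fine (Z P0 lr b) = expmom P0 Y 0 b.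
Proof. by rewrite expmom0E Z_expR. Qed.

Lemma kappa_expmom b : kappa P0 lr b = ln (expmom P0 Y 0 b).
Proof. by rewrite /kappa Z_expmom. Qed.

Lemma integral_P1 (f : X -> \bar R) : measurable_fun setT f ->
  (forall x, 0 <= f x)%E ->
  (\int[P1]_x f x = \int[P0]_x (f x * (lr x)%:E))%E.
Proof.
move=> mf f0; rewrite -(Radon_Nikodym_SigmaFinite.change_of_variables P1_ll_P0)//.
have mlr : measurable_fun setT (EFin \o lr) by exact/measurable_EFinP/measurable_lr.
have mr : measurable_fun setT (Radon_Nikodym_SigmaFinite.f P1 P0).
  exact: measurable_int (Radon_Nikodym_SigmaFinite.f_integrable P1_ll_P0).
apply: ge0_ae_eq_integral => //.
- exact: emeasurable_funM.
- exact: emeasurable_funM.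
- by move=> x _; rewrite mule_ge0// Radon_Nikodym_SigmaFinite.f_ge0.
- by case: lrP => _ lr0 _ x _; rewrite mule_ge0// lee_fin.
have := ae_eq_Radon_Nikodym_SigmaFinite P1_ll_P0 measurableT.
move=> H; apply: filterS2 H RNderiv10_ae => x /(_ I) -> h _.
by rewrite -h.
Qed.

Lemma ae_P0_P1 (Q : X -> Prop) : {ae P0, forall x, Q x} -> {ae P1, forall x, Q x}.
Proof.
move=> [N [mN N0 subN]]; exists N; split => //.
have NN : P0.-null_set N by move=> A AN mA; apply/eqP; rewrite eq_le measure_ge0 andbT -N0 le_measure// inE.
by have := P1_ll_P0 NN; apply.
Qed.

Lemma Z1 : Z P0 lr 1 = 1%E.
Proof.
rewrite Z_expR.
have <- : (\int[P1]_x cst 1 x = \int[P0]_x (expR (1 * ln (lr x)))%:E)%E.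
  rewrite integral_P1//; apply: ge0_ae_eq_integral => //.
  - by apply: emeasurable_funM => //; exact/measurable_EFinP/measurable_lr.
  - by apply/measurable_EFinP; exact: (measurable_expRM measurable_ln_lr).
  - by case: lrP => _ lr0 _ x _; rewrite mule_ge0// lee_fin.
  by have H := lr_gt0_ae; apply: filterS H => x x0 _; rewrite /= mul1e mul1r lnK.
by rewrite integral_cst// [LHS]mul1e; exact: probability_setT.
Qed.

Lemma has_expmom1 : has_expmom P0 Y 1.
Proof. by apply/Z_has_expmom; rewrite Z1 ltry. Qed.

Lemma expmom01 : expmom P0 Y 0 1 = 1.
Proof. by rewrite -Z_expmom Z1. Qed.

Lemma KL01_integral : KL P0 P1 = (\int[P0]_x (- ln (lr x))%:E)%E.
Proof.
rewrite /KL; case: pselect => [ll /=|nll]; last by case: (nll P0_ll_P1).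
have mr : measurable_fun setT (RNderiv P0 P1).
  exact: (measurable_int P1 (Radon_Nikodym_integrable (nu := charge_of_finite_measure P0) P0_ll_P1)).
apply: ae_eq_integral => //.
- by apply: measurable_lne_EFin => // x; exact: Radon_Nikodym_fin_num.
- by apply/measurable_EFinP; apply: measurable_funN; exact: measurable_ln_lr.
- by have H := RNderiv01_ae; apply: filterS H => x [x0 ->] _; rewrite lne_EFin ?invr_gt0// lnV.
Qed.

(** The finite KL(P0 || P1) only bounds an integral above. The other half comes from
    [- ln r >= - r], where [r] has [P0]-integral 1. *)
Lemma integrable_ln_lr : P0.-integrable setT (EFin \o Y).
Proof.
have : P0.-integrable setT (EFin \o (fun x => - ln (lr x))).
  apply: (@integrable_lower_bound _ _ _ _ _ (fun x => expR (1 * ln (lr x)))).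
  - by apply: measurable_funN; exact: measurable_ln_lr.
  - exact: has_expmom1.
  - by move=> x; exact: expR_ge0.
  - by move=> x; rewrite lerN2 mul1r (le_trans _ (expR_ge1Dx _))// lerDr.
  - by rewrite -KL01_integral.
move/integrableN; apply: eq_integrable => // x _ /=.
by rewrite opprK.
Qed.

Lemma expectation_ln_lr : \int[P0]_x ln (lr x) = - fine (KL P0 P1).
Proof.
rewrite KL01_integral -[X in - fine X]/(\int[P0]_x (- (EFin \o Y) x))%E.
rewrite integralN//; last first.
  by apply: integrable_add_def => //; exact: integrable_ln_lr.
rewrite fineN opprK//.
Qed.

Lemma KL10_integral : KL P1 P0 = (\int[P1]_x (ln (lr x))%:E)%E.
Proof.
rewrite /KL; case: pselect => [ll /=|nll]; last by case: (nll P1_ll_P0).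
have mr : measurable_fun setT (RNderiv P1 P0).
  exact: (measurable_int P0 (Radon_Nikodym_integrable (nu := charge_of_finite_measure P1) P1_ll_P0)).
apply: ae_eq_integral => //.
- by apply: measurable_lne_EFin => // x; exact: Radon_Nikodym_fin_num.
- by apply/measurable_EFinP; exact: measurable_ln_lr.
have H := ae_P0_P1 lr_gt0_ae; have H1 := ae_P0_P1 RNderiv10_ae.
by apply: filterS2 H H1 => x x0 -> _; rewrite lne_EFin.
Qed.

(** Same scheme with [ln r >= - 1 / r], where [1 / r] has expectation at most 1 under [P1]. *)
Lemma integrable_ln_lr_P1 : P1.-integrable setT (EFin \o Y).
Proof.
have mE : measurable_fun setT (fun x => expR (- 1 * ln (lr x))).
  exact: (measurable_expRM measurable_ln_lr).
apply: (@integrable_lower_bound _ _ _ _ _ (fun x => expR (- 1 * ln (lr x)))).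
- exact: measurable_ln_lr.
- apply/integrableP; split; first exact/measurable_EFinP.
  rewrite integral_P1//; last first.
    by apply: measurableT_comp => //; exact/measurable_EFinP.
  apply: (@le_lt_trans _ _ (\int[P0]_x cst 1 x)%E); last first.
    by rewrite integral_cst// mul1e (le_lt_trans (probability_le1 P0 measurableT))// ltry.
  apply: ae_ge0_le_integral => //.
  + by case: lrP => _ lr0 _ x _; rewrite mule_ge0// lee_fin.
  + apply: emeasurable_funM; last exact/measurable_EFinP/measurable_lr.
    by apply: measurableT_comp => //; exact/measurable_EFinP.
  have H := lr_gt0_ae; apply: filterS H => x x0 _.
  rewrite /= ger0_norm ?expR_ge0// -EFinM lee_fin mulN1r expRN lnK//.
  by rewrite mulVf// gt_eqF.
- by move=> x; exact: expR_ge0.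
- by move=> x; rewrite lerNl mulN1r (le_trans _ (expR_ge1Dx _))// lerDr.
- by rewrite -KL10_integral.
Qed.

Lemma integrable_lr_ln_lr :
  P0.-integrable setT (EFin \o (fun x => ln (lr x) * expR (ln (lr x)))).
Proof.
have mF : measurable_fun setT (EFin \o (fun x => ln (lr x) * expR (ln (lr x)))).
  apply/measurable_EFinP; apply: measurable_funM; first exact: measurable_ln_lr.
  by apply: measurableT_comp => //; exact: measurable_ln_lr.
apply/integrableP; split => //.
have /integrableP[mY fY] := integrable_ln_lr_P1.
apply: le_lt_trans fY; rewrite integral_P1//; last exact: measurableT_comp.
rewrite le_eqVlt; apply/orP; left; apply/eqP.
apply: ge0_ae_eq_integral => //.
- exact: measurableT_comp.
- by apply: emeasurable_funM; [exact: measurableT_comp|exact/measurable_EFinP/measurable_lr].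
- by case: lrP => _ lr0 _ x _; rewrite mule_ge0// lee_fin.
have H := lr_gt0_ae; apply: filterS H => x x0 _ /=.
by rewrite lnK// normrM (gtr0_norm x0).
Qed.

Lemma expectation_lr_ln_lr :
  (\int[P0]_x (ln (lr x) * expR (ln (lr x))))%:E = KL P1 P0.
Proof.
rewrite KL10_integral -(Radon_Nikodym_change_of_variables P1_ll_P0 measurableT integrable_ln_lr_P1).
rewrite /Rintegral fineK; last exact: (integrable_fin_num measurableT integrable_lr_ln_lr).
apply: ae_eq_integral => //.
- exact: measurable_int integrable_lr_ln_lr.
- apply: emeasurable_funM; first exact/measurable_EFinP/measurable_ln_lr.
  exact: (measurable_int P0 (Radon_Nikodym_integrable (nu := charge_of_finite_measure P1) P1_ll_P0)).
- have H := lr_gt0_ae.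
  apply: filterS2 H RNderiv10_ae => x x0 /= h _.
  by rewrite -/(RNderiv P1 P0 x) h lnK.
Qed.

End likelihood_ratio.

(** * The cumulant generating function *)

Section cumulant_generating.
Context d (X : measurableType d) (R : realType) (P0 P1 : probability X R).
Variable lr : X -> R.
Hypotheses (P1_ll_P0 : P1 `<< P0) (lrP : is_RNderiv P1 P0 lr)
  (KL01_fin : (KL P0 P1 < +oo)%E) (KL10_fin : (KL P1 P0 < +oo)%E)
  (log_nonconst : ~ exists c : R, {ae P0, forall x, ln (lr x) = c}).

Local Notation Y := (fun x => ln (lr x)).
Local Notation B := (Bset P0 lr).
Local Notation k := (kappa P0 lr).
Local Notation bm := (bmax P0 lr).
Local Notation gg := (g P0 lr).
Let mY : measurable_fun setT Y := measurable_ln_lr lrP.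
Let kE := kappa_expmom P1_ll_P0 lrP KL01_fin.

Lemma BsetE b : B b <-> 0 < b /\ has_expmom P0 Y b.
Proof.
by split=> -[b0 h]; split => //; apply/(Z_has_expmom P1_ll_P0 lrP KL01_fin).
Qed.

Lemma Bset_gt0 b : B b -> 0 < b. Proof. by case. Qed.

Lemma Bset_has_expmom b : B b -> has_expmom P0 Y b.
Proof. by case/BsetE. Qed.

Lemma Bset1 : B 1.
Proof. by apply/BsetE; split => //; exact: (has_expmom1 P1_ll_P0 lrP KL01_fin). Qed.

Lemma Bset_le b c : B c -> 0 < b -> b <= c -> B b.
Proof.
move=> /BsetE[_ hc] b0 bc; apply/BsetE; split => //.
by apply: (has_expmom_itv mY (ltW b0) bc) => //; exact: has_expmom0.
Qed.

Lemma Bset_bmax b : B b -> (b%:E <= bm)%E.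
Proof. by move=> Bb; apply: ereal_sup_ubound; exists b. Qed.

Lemma lt_bmaxP b : (b%:E < bm)%E -> exists2 c, B c & b < c.
Proof. by move=> /ereal_sup_gt[_ [c Bc <-]]; rewrite lte_fin; exists c. Qed.

Lemma lt_bmax b c : B c -> b < c -> (b%:E < bm)%E.
Proof. by move=> /Bset_bmax cm bc; apply: lt_le_trans cm; rewrite lte_fin. Qed.

Lemma Bset_lt_bmax b : 0 < b -> (b%:E < bm)%E -> B b.
Proof. by move=> b0 /lt_bmaxP[c Bc bc]; apply: Bset_le Bc _ (ltW bc). Qed.

Lemma kappa0 : k 0 = 0.
Proof. by rewrite kE expmom00 ln1. Qed.

Lemma kappa1 : k 1 = 0.
Proof. by rewrite kE (expmom01 P1_ll_P0 lrP KL01_fin) ln1. Qed.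

Lemma kappa_strictly_convex a b c : 0 <= a -> a < b -> b < c -> B c ->
  (c - a) * k b < (c - b) * k a + (b - a) * k c.
Proof.
move=> a0 ab bc Bc; rewrite !kE.
apply: (ln_expmom_strictly_convex mY) => //; last exact: Bset_has_expmom.
have ac : a <= c by rewrite ltW// (lt_trans ab).
apply: (has_expmom_itv mY a0 ac); first exact: has_expmom0.
exact: Bset_has_expmom.
Qed.

Definition slope a b : R := (k b - k a) / (b - a).

Lemma slope_lt_left a b c : 0 <= a -> a < b -> b < c -> B c ->
  slope a b < slope a c.
Proof.
move=> a0 ab bc Bc; have := kappa_strictly_convex a0 ab bc Bc.
rewrite /slope => h.
rewrite ltr_pdivrMr ?subr_gt0// mulrAC ltr_pdivlMr ?subr_gt0 ?(lt_trans ab)//.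
lra.
Qed.

Lemma slope_lt_right a b c : 0 <= a -> a < b -> b < c -> B c ->
  slope a c < slope b c.
Proof.
move=> a0 ab bc Bc; have := kappa_strictly_convex a0 ab bc Bc.
rewrite /slope => h.
rewrite ltr_pdivrMr ?subr_gt0 ?(lt_trans ab)// mulrAC ltr_pdivlMr ?subr_gt0//.
lra.
Qed.

Lemma slope_lt_mid a b c : 0 <= a -> a < b -> b < c -> B c ->
  slope a b < slope b c.
Proof.
by move=> a0 ab bc Bc; apply: lt_trans (slope_lt_right a0 ab bc Bc); exact: slope_lt_left.
Qed.

Lemma dquot_slope b x : dquot P0 lr b x = (slope x b)%:E.
Proof.
rewrite /dquot /slope; congr EFin.
by rewrite -(opprB (k b)) -(opprB b) invrN mulrNN.
Qed.

(* By convexity the chord slopes increase, so their supremum is the left derivative of [kappa] (possibly [+oo] at [bmax]). *)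
Definition lslope (b : R) : \bar R :=
  ereal_sup [set (slope x b)%:E | x in [set x | 0 < x < b]].

Lemma lslope_ge x b : 0 < x -> x < b -> ((slope x b)%:E <= lslope b)%E.
Proof.
by move=> x0 xb; apply: ereal_sup_ubound; exists x => //=; rewrite x0 xb.
Qed.

Lemma slope_lt_lslope a b : 0 <= a -> a < b -> B b -> ((slope a b)%:E < lslope b)%E.
Proof.
move=> a0 ab Bb; pose x := (a + b) / 2.
have ax : a < x by rewrite /x; lra.
have xb : x < b by rewrite /x; lra.
apply: lt_le_trans (lslope_ge (le_lt_trans a0 ax) xb).
by rewrite lte_fin; exact: slope_lt_right.
Qed.

Lemma lslope_lt_slope b c : B c -> 0 < b -> b < c -> (lslope b < (slope b c)%:E)%E.
Proof.
move=> Bc b0 bc; pose x := (b + c) / 2.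
have bx : b < x by rewrite /x; lra.
have xc : x < c by rewrite /x; lra.
apply: (@le_lt_trans _ _ (slope b x)%:E).
  apply: ge_ereal_sup => _ [a /= /andP[a0 ab] <-].
  rewrite lee_fin ltW//; apply: slope_lt_mid => //; first exact: ltW.
  exact: Bset_le Bc (lt_trans b0 bx) (ltW xc).
by rewrite lte_fin; apply: slope_lt_left => //; exact: ltW.
Qed.

Lemma lslope_fin_num b c : B c -> 0 < b -> b < c -> lslope b \is a fin_num.
Proof.
move=> Bc b0 bc; rewrite fin_numElt; apply/andP; split.
  have Bb : B b by apply: Bset_le Bc b0 (ltW bc).
  by apply: lt_trans (slope_lt_lslope (lexx 0) b0 Bb); exact: ltNyr.
by apply: lt_trans (lslope_lt_slope Bc b0 bc) _; exact: ltry.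
Qed.

Lemma dquot_cvg b : B b -> dquot P0 lr b x @[x --> b^'-] --> lslope b.
Proof.
move=> Bb; have b0 := Bset_gt0 Bb.
apply/cvg_at_leftNP.
have e : lslope b = ereal_sup ((dquot P0 lr b \o -%R) @` [set` `](- b), 0[%R]).
  rewrite /lslope; congr ereal_sup; apply/seteqP; split => _ [x /= xb <-].
    exists (- x); last by rewrite /= opprK dquot_slope.
    by rewrite /= in_itv/= ltrN2 oppr_lt0 andbC.
  move: xb; rewrite in_itv/= => /andP[bx x0].
  exists (- x); last by rewrite dquot_slope.
  by rewrite /= oppr_gt0 x0 ltrNl.
rewrite e; apply: nonincreasing_at_right_cvge.
  by rewrite bnd_simp oppr_lt0.
move=> x y; rewrite !in_itv/= => /andP[bx x0] /andP[by_ y0].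
rewrite le_eqVlt => /predU1P[-> //|xy].
rewrite !dquot_slope lee_fin ltW//; apply: slope_lt_right => //.
- by rewrite oppr_ge0 ltW.
- by rewrite ltrN2.
- by rewrite ltrNl.
Qed.

(** * Derivatives of [kappa] below [bmax], and the function [g] *)

Lemma expmom_derivable j b : 0 < b -> (b%:E < bm)%E ->
  is_derive b 1 (expmom P0 Y j) (expmom P0 Y j.+1 b).
Proof.
move=> b0 /lt_bmaxP[c Bc bc].
apply: (is_derive_expmom mY _ b0 bc); first exact: has_expmom0.
exact: Bset_has_expmom.
Qed.

(** Mean of [ln lr] under the law with density proportional to [expR (b * ln lr)]; it is the
    derivative of [kappa] below [bmax]. *)
Definition tilted_mean b : R := expmom P0 Y 1 b / expmom P0 Y 0 b.

Lemma expmom0_Bset_gt0 b : B b -> 0 < expmom P0 Y 0 b.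
Proof. by move=> Bb; apply: expmom0_gt0 => //; exact: Bset_has_expmom. Qed.

Lemma kappa_derivable b : 0 < b -> (b%:E < bm)%E ->
  is_derive b 1 k (tilted_mean b).
Proof.
move=> b0 bb; have Bb := Bset_lt_bmax b0 bb.
have d0 := expmom_derivable 0 b0 bb.
rewrite (_ : k = @ln R \o expmom P0 Y 0); last by apply/funext => x; rewrite /= kE.
have := @is_derive1_comp _ (@ln R) (expmom P0 Y 0) b _ _
  (is_derive1_ln (expmom0_Bset_gt0 Bb)) d0.
by move/is_derive_eq; apply; rewrite mulrC.
Qed.

Lemma derive1_kappa b : 0 < b -> (b%:E < bm)%E -> derive1 k b = tilted_mean b.
Proof. by move=> b0 bb; rewrite derive1E; have [_ ->] := kappa_derivable b0 bb. Qed.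

Lemma tilted_mean_continuous b : 0 < b -> (b%:E < bm)%E ->
  {for b, continuous tilted_mean}.
Proof.
move=> b0 bb.
have c j : {for b, continuous (expmom P0 Y j)}.
  apply: differentiable_continuous; apply/derivable1_diffP.
  by have [] := expmom_derivable j b0 bb.
have Z0 := expmom0_Bset_gt0 (Bset_lt_bmax b0 bb).
apply: cvgM; first exact: c.
by apply: cvgV; [rewrite gt_eqF|exact: c].
Qed.

Lemma kappa_continuous b : 0 < b -> (b%:E < bm)%E -> {for b, continuous k}.
Proof.
move=> b0 bb; apply: differentiable_continuous; apply/derivable1_diffP.
by have [] := kappa_derivable b0 bb.
Qed.

Lemma lslope_tilted_mean b : 0 < b -> (b%:E < bm)%E ->
  lslope b = (tilted_mean b)%:E.
Proof.
move=> b0 bb; have Bb := Bset_lt_bmax b0 bb.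
suff h : dquot P0 lr b x @[x --> b^'-] --> (tilted_mean b)%:E.
  exact: (cvg_unique _ (dquot_cvg Bb) h).
apply/cvge_at_leftP => u [ub cu]; apply: cvg_EFin; first exact: nearW.
have [dd dv] := kappa_derivable b0 bb.
have dl : (h : R)^-1 * (k (h * 1 + b) - k b) @[h --> (0 : R)^'] -->
    ('D_1 k b : R) := dd.
rewrite dv in dl; have /cvgr_dnbhsP := dl.
move=> /(_ (fun n => u n - b)) H.
have : (forall n, u n - b != 0) /\ u n - b @[n --> \oo] --> (0 : R).
  split; first by move=> n; rewrite subr_eq0 lt_eqF.
  by rewrite -(subrr b); apply: cvgB => //; exact: cvg_cst.
move=> /H; apply: cvg_trans; apply: near_eq_cvg; apply: nearW => n /=.
by rewrite mulr1 subrK mulrC.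
Qed.

(** Merges the two branches of [dkappa], so that later convexity arguments need no case distinction
    at [bmax]. *)
Lemma dkappa_lslope b : B b -> dkappa P0 lr b = lslope b.
Proof.
move=> Bb; rewrite /dkappa; case: ifPn => [bb|_].
  by rewrite derive1_kappa// ?Bset_gt0// lslope_tilted_mean// Bset_gt0.
by apply: cvg_lim => //; exact: dquot_cvg.
Qed.

Lemma gE b : B b -> gg b = (b%:E * lslope b - (k b)%:E)%E.
Proof. by move=> Bb; rewrite /g dkappa_lslope. Qed.

(** Real-valued form of [g] below [bmax], to which continuity and intermediate values apply. *)
Definition gr b : R := b * tilted_mean b - k b.

Lemma g_gr b : 0 < b -> (b%:E < bm)%E -> gg b = (gr b)%:E.
Proof.
by move=> b0 bb; rewrite gE ?lslope_tilted_mean//; exact: Bset_lt_bmax.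
Qed.

Lemma gr_continuous b : 0 < b -> (b%:E < bm)%E -> {for b, continuous gr}.
Proof.
move=> b0 bb; apply: cvgB; last exact: kappa_continuous.
by apply: cvgM => //; exact: tilted_mean_continuous.
Qed.

(* [- g b] is the ordinate at 0 of the tangent at [b]; both sides are compared with the chord over [b, b']. *)
Lemma g_strictly_increasing b b' : B b -> B b' -> b < b' -> (gg b < gg b')%E.
Proof.
move=> Bb Bb' bb'; have b0 := Bset_gt0 Bb; have b'0 := Bset_gt0 Bb'.
rewrite (gE Bb) (gE Bb').
have /fineK r := lslope_fin_num Bb' b0 bb'.
rewrite -r; have := lslope_lt_slope Bb' b0 bb'; rewrite -r lte_fin => rs.
apply: (@lt_trans _ _ (b'%:E * (slope b b')%:E - (k b')%:E)%E).
  rewrite -!EFinM -!EFinB lte_fin.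
  have -> : k b' = k b + slope b b' * (b' - b).
    by rewrite /slope divfK ?subr_eq0 ?gt_eqF// addrC subrK.
  rewrite -subr_gt0 (_ : _ - _ = b * (slope b b' - fine (lslope b))); last by ring.
  by rewrite mulr_gt0 ?subr_gt0.
rewrite lteD2rE// lte_pmul2l ?lte_fin//.
by apply: slope_lt_lslope => //; exact: ltW.
Qed.

Lemma g_inj b b' : B b -> B b' -> gg b = gg b' -> b = b'.
Proof.
move=> Bb Bb' e; have [bb'|b'b|//] := ltgtP b b'.
  by have := g_strictly_increasing Bb Bb' bb'; rewrite e ltxx.
by have := g_strictly_increasing Bb' Bb b'b; rewrite e ltxx.
Qed.

Lemma g_ltE b b' : B b -> B b' -> (gg b < gg b')%E = (b < b').
Proof.
move=> Bb Bb'; have [bb'|b'b|->] := ltgtP b b'.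
- exact: g_strictly_increasing.
- by apply/negbTE; rewrite -leNgt ltW// g_strictly_increasing.
- by rewrite ltxx.
Qed.

(** The chord from the origin to [b] is less steep than the tangent at [b]. *)
Lemma gr_gt0 b : 0 < b -> (b%:E < bm)%E -> 0 < gr b.
Proof.
move=> b0 bb; have Bb := Bset_lt_bmax b0 bb.
have := slope_lt_lslope (lexx 0) b0 Bb.
by rewrite lslope_tilted_mean// lte_fin /slope kappa0 !subr0 ltr_pdivrMr// mulrC -subr_gt0.
Qed.

Lemma g_gt0 b : B b -> (0 < gg b)%E.
Proof.
(* Halving [b] gives a point strictly below [bmax], where [g] is the real number [gr]. *)
move=> Bb; have b0 := Bset_gt0 Bb; have b2 : b / 2 < b by lra.
have b20 : 0 < b / 2 by lra.
apply: lt_trans (g_strictly_increasing (Bset_le Bb b20 (ltW b2)) Bb b2).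
by rewrite g_gr ?lte_fin ?gr_gt0//; exact: lt_bmax b2.
Qed.

Lemma tilted_mean_lt b c : 0 < b -> b < c -> (c%:E < bm)%E ->
  tilted_mean b < tilted_mean c.
Proof.
move=> b0 bc cb; have c0 := lt_trans b0 bc; have Bc := Bset_lt_bmax c0 cb.
rewrite -lte_fin -!lslope_tilted_mean//; last exact: lt_bmax bc.
by apply: lt_trans (lslope_lt_slope Bc b0 bc) _; exact: slope_lt_lslope (ltW b0) bc Bc.
Qed.

(** Jensen's inequality at exponent 0; it stands in for the tangent there, where a two-sided
    derivative need not exist. *)
Lemma kappa_ge b : B b -> - fine (KL P0 P1) * b <= k b.
Proof.
move=> Bb.
have i0 : P0.-integrable setT (EFin \o (fun x => ln (lr x) * expR (0 * ln (lr x)))).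
  have := integrable_ln_lr P1_ll_P0 lrP KL01_fin.
  by apply: eq_integrable => // x _ /=; rewrite mul0r expR0 mulr1.
have := ln_expmom_tangent i0 (has_expmom0 P0 Y) (Bset_has_expmom Bb).
rewrite expmom00 ln1 add0r divr1 subr0 -kE => h; apply: le_trans h.
rewrite -(expectation_ln_lr P1_ll_P0 lrP KL01_fin) expmom1E.
rewrite le_eqVlt; apply/orP; left; apply/eqP; congr (_ * _).
by apply: eq_Rintegral => x _; rewrite mul0r expR0 mulr1.
Qed.

(** Since 1 lies in [Bset], one half is a reference exponent at which [kappa] is smooth whatever
    [bmax] is. *)
Lemma half_lt_bmax : ((2^-1 : R)%:E < bm)%E.
Proof. by apply: lt_bmax Bset1 _; lra. Qed.

Let half_gt0 : 0 < (2^-1 : R). Proof. by rewrite invr_gt0. Qed.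

(** Makes [gr] of order [b] at 0: the slope is at most its value at one half, and [- kappa b] is at
    most [b] times the finite KL(P0 || P1). *)
Lemma gr_le b : 0 < b -> b < 2^-1 ->
  gr b <= b * (tilted_mean 2^-1 + fine (KL P0 P1)).
Proof.
move=> b0 b2.
have bb : (b%:E < bm)%E by apply: lt_trans half_lt_bmax; rewrite lte_fin.
have := kappa_ge (Bset_lt_bmax b0 bb).
have := tilted_mean_lt b0 b2 half_lt_bmax.
rewrite -(ltr_pM2l b0) /gr => h1 h2; rewrite mulrDr lerD//; first exact: ltW.
by rewrite mulrC lerNl -mulNr.
Qed.

Lemma gr_cvg0 : gr b @[b --> 0^'+] --> 0.
Proof.
apply: (@squeeze_cvgr _ _ _ _ (cst 0) (fun b => b * (tilted_mean 2^-1 + fine (KL P0 P1)))).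
- near=> b.
  have b0 : 0 < b by [].
  have b2 : b < 2^-1 by near: b; exact: nbhs_right_lt.
  rewrite gr_le// andbT ltW// gr_gt0//.
  by apply: lt_trans half_lt_bmax; rewrite lte_fin.
- exact: cvg_cst.
- rewrite -[X in _ --> X](mul0r (tilted_mean 2^-1 + fine (KL P0 P1))).
  by apply: cvgMr_tmp; exact: cvg_at_right_filter.
Unshelve. all: by end_near. Qed.

Lemma g_cvg0 : gg b @[b --> 0^'+] --> (0 : \bar R)%E.
Proof.
apply: (@cvg_trans _ ((gr b)%:E @[b --> 0^'+])).
  apply: near_eq_cvg; near=> b.
  rewrite g_gr//; apply: lt_trans half_lt_bmax.
  by rewrite lte_fin; near: b; exact: nbhs_right_lt.
apply: cvg_EFin; first exact: nearW.
exact: gr_cvg0.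
Unshelve. all: by end_near. Qed.

(** The offset 2 keeps every term strictly between 0 and 1, also for [n = 0]. *)
Let seq1 (n : nat) : R := 1 - (n.+2%:R)^-1.

Let seq1_bd n : 0 <= seq1 n < 1.
Proof.
rewrite /seq1 ltrBlDr ltrDl invr_gt0 ltr0n andbT subr_ge0.
by rewrite invf_le1// ?ler1n ?ltr0n.
Qed.

Let seq1_gt0 n : 0 < seq1 n.
Proof. by rewrite subr_gt0 invf_lt1 ?ltr0n// ltr1n. Qed.

Let invSS_cvg : (n.+2%:R : R)^-1 @[n --> \oo] --> 0.
Proof.
by rewrite (cvg_shiftS (fun n => (n.+1%:R : R)^-1)); exact: cvg_harmonic.
Qed.

Let seq1_cvg : seq1 n @[n --> \oo] --> (1 : R).
Proof.
rewrite -[X in _ --> X]subr0; apply: cvgB; first exact: cvg_cst.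
exact: invSS_cvg.
Qed.

(** The upper bound is the tangent inequality at 1. For the lower bound, [ln z <= z - 1] and
    [Z 1 = 1] show that chord slopes of [kappa] ending at 1 dominate those of the moment, whose
    limit is KL(P1 || P0). *)
Lemma lslope1 : lslope 1 = KL P1 P0.
Proof.
have iYe := integrable_lr_ln_lr P1_ll_P0 lrP KL01_fin KL10_fin.
have h1 := has_expmom1 P1_ll_P0 lrP KL01_fin.
have K := expectation_lr_ln_lr P1_ll_P0 lrP KL01_fin KL10_fin.
apply/eqP; rewrite eq_le; apply/andP; split.
  apply: ge_ereal_sup => _ [x /= /andP[x0 x1] <-].
  rewrite -K lee_fin /slope kappa1 sub0r ler_pdivrMr ?subr_gt0// lerNl.
  have i1 : P0.-integrable setT (EFin \o (fun x => ln (lr x) * expR (1 * ln (lr x)))).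
    by apply: eq_integrable iYe => // y _ /=; rewrite mul1r.
  have := ln_expmom_tangent i1 h1 (Bset_has_expmom (Bset_le Bset1 x0 (ltW x1))).
  rewrite (expmom01 P1_ll_P0 lrP KL01_fin) ln1 add0r divr1 -kE expmom1E.
  rewrite (_ : (fun y => _ * expR (1 * _)) = (fun y => ln (lr y) * expR (ln (lr y)))).
    by move=> h; apply: le_trans h; rewrite -mulrN opprB.
  by apply/funext => y; rewrite mul1r.
rewrite -K leNgt; apply/negP => lK.
have cs := expmom0_slope1_cvg mY h1 iYe seq1_bd seq1_cvg.
have ls : (lslope 1 \is a fin_num).
  rewrite fin_numElt; apply/andP; split.
    by apply: lt_trans (slope_lt_lslope (lexx 0) ltr01 Bset1); exact: ltNyr.
  by apply: lt_trans lK _; exact: ltry.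
move: lK; rewrite -(fineK ls) lte_fin => lK.
have [n _ Hn] := cvgr_gt _ cs _ lK.
have := Hn n (leqnn n).
rewrite /= (expmom01 P1_ll_P0 lrP KL01_fin) => hn.
have /andP[_ s1] := seq1_bd n.
have := lslope_ge (seq1_gt0 n) s1; rewrite -(fineK ls) lee_fin /slope kappa1 sub0r.
apply/negP; rewrite -ltNge; apply: (lt_le_trans hn).
rewrite ler_pM2r ?invr_gt0 ?subr_gt0// kE.
have Zn : 0 < expmom P0 Y 0 (seq1 n).
  by apply: expmom0_Bset_gt0; apply: Bset_le Bset1 _ (ltW s1).
rewrite lerNr opprB; move: (expmom P0 Y 0 (seq1 n)) Zn => z z0.
have h : -1 < z - 1 by rewrite ltrBrDl subrr.
by have := le_ln1Dx h; rewrite subrKC.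
Qed.

Lemma g1 : gg 1 = KL P1 P0.
Proof. by rewrite gE ?lslope1 ?kappa1 ?mul1e ?sube0//; exact: Bset1. Qed.

(** Left continuity of [kappa] along an explicit sequence, available at [b = bmax] too; [x] keeps
    the sequence away from 0. *)
Lemma kappa_seq_cvg x b : 0 < x -> x < b -> B b ->
  [/\ forall n : nat, x < b - (b - x) / n.+2%:R < b,
      b - (b - x) / n.+2%:R @[n --> \oo] --> b &
      k (b - (b - x) / n.+2%:R) @[n --> \oo] --> k b].
Proof.
move=> x0 xb Bb; have b0 := Bset_gt0 Bb.
have bd n : x < b - (b - x) / n.+2%:R < b.
  have n0 : 0 < (n.+2%:R : R)^-1 by rewrite invr_gt0 ltr0n.
  have n1 : (n.+2%:R : R)^-1 < 1 by rewrite invf_lt1 ?ltr0n// ltr1n.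
  have bx : 0 < b - x by rewrite subr_gt0.
  by rewrite ltrBrDl -ltrBrDr gtr_pMr// n1 ltrBlDr ltrDl divr_gt0// ltr0n.
have cb : b - (b - x) / n.+2%:R @[n --> \oo] --> b.
  rewrite -[X in _ --> X]subr0; apply: cvgB; first exact: cvg_cst.
  by rewrite -(mulr0 (b - x)); apply: cvgMl_tmp; exact: invSS_cvg.
split => //.
rewrite kE; under eq_cvg do rewrite kE.
apply: continuous_cvg; first by apply: continuous_ln; exact: expmom0_Bset_gt0.
apply: (expmom0_cvg mY (ltW b0) (Bset_has_expmom Bb)) => // n.
have /andP[h1 h2] := bd n.
by rewrite !ltW// (lt_trans x0).
Qed.

Lemma lslope_tangent b c r : B b -> lslope b = r%:E -> B c -> c != b ->
  k b + r * (c - b) < k c.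
Proof.
move=> Bb er Bc; have b0 := Bset_gt0 Bb; have c0 := Bset_gt0 Bc.
rewrite neq_lt => /orP[cb|bc].
  have := slope_lt_lslope (ltW c0) cb Bb.
  by rewrite er lte_fin /slope ltr_pdivrMr ?subr_gt0//; lra.
have := lslope_lt_slope Bc b0 bc.
by rewrite er lte_fin /slope ltr_pdivlMr ?subr_gt0//; lra.
Qed.

(** * The optimal exponent *)

(* [chord y b] is the slope of the line through [(0, - y)] and [(b, kappa b)]; minimising [Bt] means minimising this slope, and it is minimal where the line is tangent to the graph of [kappa]. *)
Definition chord (y b : R) : R := (k b + y) / b.

Lemma Bt_chord l t b : t != 0 -> b != 0 -> Bt P0 lr l t b = t * chord (l / t) b.
Proof.
by move=> t0 b0; rewrite /Bt /lambda /chord; field; rewrite t0 b0.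
Qed.

Lemma ltr_Bt l t b c : 0 < t -> B b -> B c ->
  (Bt P0 lr l t b < Bt P0 lr l t c) = (chord (l / t) b < chord (l / t) c).
Proof.
move=> t0 /Bset_gt0 b0 /Bset_gt0 c0.
by rewrite !Bt_chord ?gt_eqF// ltr_pM2l.
Qed.

(** A real value of [g b] excludes an infinite left slope, in particular at [bmax]. *)
Lemma g_lslope y b : B b -> gg b = y%:E -> lslope b = (chord y b)%:E.
Proof.
move=> Bb; have b0 := Bset_gt0 Bb; rewrite gE//.
case: (lslope b) => [r| |].
- rewrite -EFinM -EFinB => -[<-]; congr EFin.
  by rewrite /chord addrC subrK mulrC mulKf ?gt_eqF.
- by rewrite gt0_muley ?lte_fin.
- by rewrite gt0_muleNy ?lte_fin.
Qed.

Lemma chord_min y b c : B b -> gg b = y%:E -> B c -> c != b ->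
  chord y b < chord y c.
Proof.
move=> Bb gb Bc cb; have c0 := Bset_gt0 Bc; have b0 := Bset_gt0 Bb.
have := lslope_tangent Bb (g_lslope Bb gb) Bc cb.
rewrite [X in _ -> _ < X]/chord ltr_pdivlMr// => h.
have e : chord y b * b = k b + y by rewrite /chord divfK// gt_eqF.
lra.
Qed.

(** [b * chord y b] differs from [kappa b] by the constant [y], so it inherits strict convexity. *)
Lemma chord_lt_convex y a b c : B a -> a < b -> b < c -> B c ->
  (c - a) * (b * chord y b) < (c - b) * (a * chord y a) + (b - a) * (c * chord y c).
Proof.
move=> Ba ab bc Bc; have a0 := Bset_gt0 Ba.
have e x : 0 < x -> x * chord y x = k x + y.
  by move=> x0; rewrite /chord mulrC divfK// gt_eqF.
have b0 := lt_trans a0 ab; have c0 := lt_trans b0 bc.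
rewrite !e//; have := kappa_strictly_convex (ltW a0) ab bc Bc; lra.
Qed.

Lemma chord_decreasing y b0 b b' : B b0 -> gg b0 = y%:E -> B b -> b < b' -> b' <= b0 ->
  chord y b' < chord y b.
Proof.
move=> B0 g0 Bb bb'; rewrite le_eqVlt => /predU1P[e|b'0].
  by rewrite e in bb' *; apply: chord_min => //; rewrite lt_eqF.
have bgt0 := Bset_gt0 Bb.
have bb0 := lt_trans bb' b'0.
have hm : chord y b0 < chord y b by apply: chord_min => //; rewrite lt_eqF.
(* Since [(b0 - b') * b + (b' - b) * b0 = (b0 - b) * b'], replacing [chord y b0] by the larger
   [chord y b] collapses the right-hand side to a multiple of [chord y b]. *)
have hc := chord_lt_convex y Bb bb' b'0 B0.
have h1 : (b' - b) * (b0 * chord y b0) < (b' - b) * (b0 * chord y b).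
  by rewrite ltr_pM2l ?subr_gt0// ltr_pM2l// (lt_trans bgt0).
have h2 := lt_trans hc (ler_ltD (lexx _) h1).
have : (b0 - b) * (b' * chord y b') < (b0 - b) * (b' * chord y b) by lra.
by rewrite ltr_pM2l ?subr_gt0// ltr_pM2l// (lt_trans bgt0).
Qed.

Lemma chord_increasing y b0 b b' : B b0 -> gg b0 = y%:E -> b0 <= b -> b < b' -> B b' ->
  chord y b < chord y b'.
Proof.
move=> B0 g0; rewrite le_eqVlt => /predU1P[<-|b0b] bb' Bb'.
  by apply: chord_min => //; rewrite gt_eqF.
have b0gt0 := Bset_gt0 B0.
have b0b' := lt_trans b0b bb'.
have hm : chord y b0 < chord y b' by apply: chord_min => //; rewrite gt_eqF.
have hc := chord_lt_convex y B0 b0b bb' Bb'.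
have h1 : (b' - b) * (b0 * chord y b0) < (b' - b) * (b0 * chord y b').
  by rewrite ltr_pM2l ?subr_gt0// ltr_pM2l.
have h2 := lt_trans hc (ltr_leD h1 (lexx _)).
have : (b' - b0) * (b * chord y b) < (b' - b0) * (b * chord y b') by lra.
by rewrite ltr_pM2l ?subr_gt0// ltr_pM2l// (lt_trans b0gt0).
Qed.

Lemma is_beta_starP l t b : 0 < t -> B b -> gg b = (l / t)%:E ->
  is_beta_star P0 lr l t b.
Proof.
move=> t0 Bb gb; split => //; first by exists b.
by move=> b' Bb' b'b; rewrite ltr_Bt//; exact: chord_min.
Qed.

(** Two distinct strict minimisers would each beat the other, so [xget] can return only [b]. *)
Lemma beta_starE l t b : 0 < t -> B b -> gg b = (l / t)%:E ->
  beta_star P0 lr l t = b.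
Proof.
move=> t0 Bb gb; have hb := is_beta_starP t0 Bb gb.
have [] := xgetPex 0 (ex_intro [set b | is_beta_star P0 lr l t b] b hb).
rewrite -/(beta_star P0 lr l t) => _ Bs hs.
apply/eqP; apply: contraT => sb; have [_ _ hb'] := hb.
have := lt_trans (hs _ Bb _) (hb' _ Bs sb).
by rewrite eq_sym sb ltxx => /(_ isT).
Qed.

Lemma beta_star_hits l t : 0 < t -> in_range_g P0 lr (l / t) ->
  B (beta_star P0 lr l t) /\ gg (beta_star P0 lr l t) = (l / t)%:E.
Proof. by move=> t0 [b Bb gb]; rewrite (beta_starE t0 Bb gb). Qed.

(** Intermediate values of [gr] between [b] and a point so close to 0 that [gr] is still below
    [y]. *)
Lemma in_range_g_le y b : 0 < y -> 0 < b -> (b%:E < bm)%E -> y <= gr b ->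
  in_range_g P0 lr y.
Proof.
move=> y0 b0 bb yb.
have : \forall a \near 0^'+, gr a < y by exact: (cvgr_lt _ gr_cvg0).
move=> H.
have [a [a0 ab ay]] : exists a, [/\ 0 < a, a < b & gr a < y].
  near (0 : R)^'+ => a; exists a; split; near: a => //.
    exact: nbhs_right_gt.
  exact: nbhs_right_lt.
have cont : {within `[a, b], continuous gr}.
  apply: continuous_in_subspaceT => x; rewrite inE/= in_itv/= => /andP[ax xb].
  apply: gr_continuous; first exact: lt_le_trans ax.
  by apply: le_lt_trans bb; rewrite lee_fin.
have [] := IVT (ltW ab) cont (v := y).
  by rewrite ge_min (ltW ay) le_max yb orbT.
move=> c; rewrite in_itv/= => /andP[ac cb] gc.
have c0 : 0 < c by exact: lt_le_trans ac.
have cbm : (c%:E < bm)%E by apply: le_lt_trans bb; rewrite lee_fin.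
by exists c; [exact: Bset_lt_bmax|rewrite g_gr// gc].
Unshelve. all: by end_near. Qed.

Lemma gr_lt_not_in_range y b : 0 < y -> ~ in_range_g P0 lr y -> 0 < b ->
  (b%:E < bm)%E -> gr b < y.
Proof.
move=> y0 ny b0 bb; rewrite ltNge; apply/negP => yb; apply: ny.
exact: in_range_g_le yb.
Qed.

Lemma kappa_tangent b c : 0 < b -> (b%:E < bm)%E -> B c ->
  k b + tilted_mean b * (c - b) <= k c.
Proof.
move=> b0 bb Bc; have [->|cb] := eqVneq c b; first by rewrite subrr mulr0 addr0.
by apply/ltW/lslope_tangent => //; [exact: Bset_lt_bmax|exact: lslope_tilted_mean].
Qed.

(** The tangent inequality at [b] with denominators cleared. The sign of [gr b - y] thus tells on
    which side of [b] the chords are larger, whether or not a minimiser exists. *)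
Lemma chord_sub_ge y b c : 0 < b -> (b%:E < bm)%E -> B c ->
  (c - b) * (gr b - y) / (b * c) <= chord y c - chord y b.
Proof.
move=> b0 bb Bc; have c0 := Bset_gt0 Bc.
rewrite ler_pdivrMr ?mulr_gt0//.
have -> : (chord y c - chord y b) * (b * c) = b * (k c + y) - c * (k b + y).
  by rewrite /chord; field; rewrite !gt_eqF.
have := kappa_tangent b0 bb Bc; rewrite -(ler_pM2l b0) /gr; lra.
Qed.

Lemma chord_seq_cvg y x b : 0 < x -> x < b -> B b ->
  chord y (b - (b - x) / n.+2%:R) @[n --> \oo] --> chord y b.
Proof.
move=> x0 xb Bb; have b0 := Bset_gt0 Bb.
have [_ cb ck] := kappa_seq_cvg x0 xb Bb.
apply: cvgM; first by apply: cvgD => //; exact: cvg_cst.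
by apply: cvgV => //; rewrite gt_eqF.
Qed.

Lemma chord_decreasing_not_in_range y b b' : 0 < y -> ~ in_range_g P0 lr y ->
  B b -> B b' -> b < b' -> chord y b' < chord y b.
Proof.
move=> y0 ny.
have h c c' : B c -> c < c' -> (c'%:E < bm)%E -> chord y c' < chord y c.
  move=> Bc cc' c'b; have c0 := Bset_gt0 Bc; have c'0 := lt_trans c0 cc'.
  have := chord_sub_ge y c'0 c'b Bc; rewrite -[_ < _]subr_gt0; apply: lt_le_trans.
  apply: divr_gt0; last exact: mulr_gt0.
  by rewrite nmulr_rgt0 ?subr_lt0//; exact: gr_lt_not_in_range.
move=> Bb Bb' bb'; have b0 := Bset_gt0 Bb.
(* If [b'] is [bmax], its chord is only a limit of chords below [chord y x], which gives a weak
   inequality; the midpoint restores strictness. *)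
pose x := (b + b') / 2.
have bx : b < x by rewrite /x; lra.
have xb' : x < b' by rewrite /x; lra.
have x0 := lt_trans b0 bx.
apply: (@le_lt_trans _ _ (chord y x)); last first.
  by apply: h => //; exact: lt_bmax xb'.
have [bd _ _] := kappa_seq_cvg x0 xb' Bb'.
apply: (cvgr_to_le (chord_seq_cvg (y := y) x0 xb' Bb')).
apply: nearW => n; have /andP[h1 h2] := bd n.
apply/ltW/h => //; first exact: Bset_le Bb' x0 (ltW xb').
exact: lt_bmax h2.
Qed.

Lemma Bt_decreasing_not_hits l t b b' : 0 < l -> 0 < t ->
  ~ in_range_g P0 lr (l / t) -> B b -> B b' -> b < b' ->
  Bt P0 lr l t b' < Bt P0 lr l t b.
Proof.
move=> l0 t0 nh Bb Bb' bb'; rewrite ltr_Bt//.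
by apply: chord_decreasing_not_in_range => //; exact: divr_gt0.
Qed.

(** A decreasing function tends to its infimum at the right end. The filter lives on [\bar R] so
    that finite and infinite [bmax] are treated alike. *)
Lemma Bt_cvg_bmax l t : 0 < l -> 0 < t -> ~ in_range_g P0 lr (l / t) ->
  (Bt P0 lr l t (fine y))%:E @[y --> within [set y | (y < bm)%E] (nbhs bm)]
    --> ereal_inf [set (Bt P0 lr l t b)%:E | b in B].
Proof.
move=> l0 t0 nh; set F := within _ _; set L := ereal_inf _.
have FF : Filter F by exact: within_filter.
have nearB a : B a -> (a%:E < bm)%E -> \forall y \near F, a < fine y /\ B (fine y).
  move=> Ba abm; rewrite /F near_withinE.
  have : \forall y \near nbhs bm, (a%:E < y)%E by exact: open_ereal_gt'.
  apply: filterS => -[y|_|ay _]; last 2 first.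
  - by rewrite /= ltNge leey.
  - by move: ay; rewrite ltNge leNye.
  rewrite lte_fin /= => ay yb; split => //.
  by apply: Bset_lt_bmax => //; exact: lt_trans (Bset_gt0 Ba) ay.
have lower : \forall y \near F, (L <= (Bt P0 lr l t (fine y))%:E)%E.
  have Bh : B 2^-1 by apply: Bset_lt_bmax => //; exact: half_lt_bmax.
  apply: filterS (nearB _ Bh half_lt_bmax) => y [_ By].
  by apply: ereal_inf_lbound; exists (fine y).
have upper (a : \bar R) : (L < a)%E -> \forall y \near F, ((Bt P0 lr l t (fine y))%:E < a)%E.
  move=> /ereal_inf_lt[_ [b Bb <-]] ba.
  (* A near-optimal exponent may be [bmax] itself; left continuity then moves it strictly below
     [bmax]. *)
  have [c [Bc cb ca]] : exists c, [/\ B c, (c%:E < bm)%E & ((Bt P0 lr l t c)%:E < a)%E].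
    have [bb|bb] := boolP (b%:E < bm)%E; first by exists b.
    have b0 := Bset_gt0 Bb.
    have b20 : 0 < b / 2 by rewrite divr_gt0.
    have b2 : b / 2 < b by lra.
    have cc := chord_seq_cvg (y := l / t) b20 b2 Bb.
    have [bd _ _] := kappa_seq_cvg b20 b2 Bb.
    have cB : Bt P0 lr l t (b - (b - b / 2) / n.+2%:R) @[n --> \oo] --> Bt P0 lr l t b.
      rewrite Bt_chord ?gt_eqF//.
      have -> : (fun n : nat => Bt P0 lr l t (b - (b - b / 2) / n.+2%:R)) =
          (fun n : nat => t * chord (l / t) (b - (b - b / 2) / n.+2%:R)).
        apply/funext => n; rewrite Bt_chord ?gt_eqF//.
        by have /andP[h1 _] := bd n; exact: lt_trans h1.
      by apply: cvgMl_tmp.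
    have : \forall n \near \oo, ((Bt P0 lr l t (b - (b - b / 2) / n.+2%:R))%:E < a)%E.
      case: a ba => [a| |] //=; last by move=> _; apply: nearW => n; exact: ltry.
      rewrite lte_fin => ba; have H := cvgr_lt _ cB _ ba.
      by near=> n; rewrite lte_fin; near: n; exact: H.
    move=> [n _ /(_ n (leqnn n)) /= hn].
    exists (b - (b - b / 2) / n.+2%:R); have /andP[h1 h2] := bd n; split => //.
      by apply: Bset_le Bb (lt_trans b20 h1) (ltW h2).
    exact: lt_bmax h2.
  apply: filterS (nearB _ Bc cb) => y [cy By].
  by apply: lt_trans ca; rewrite lte_fin; exact: Bt_decreasing_not_hits.
have Ly : (L < +oo)%E.
  apply: (@le_lt_trans _ _ (Bt P0 lr l t 1)%:E); last exact: ltry.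
  by apply: ereal_inf_lbound; exists 1 => //; exact: Bset1.
case: (L) lower upper Ly => [r| |] lower upper Ly.
- apply: cvg_EFin; first exact: nearW.
  apply/cvgrPdist_lt => e e0.
  have re : (r%:E < (r + e)%:E)%E by rewrite lte_fin ltrDl.
  apply: filterS2 lower (upper _ re) => y; rewrite lee_fin lte_fin /= => h1 h2.
  by rewrite distrC ger0_norm ?subr_ge0// ltrBlDl.
- by rewrite ltxx in Ly.
- apply/cvgeNyPlt => A; apply: upper; exact: ltNyr.
Unshelve. all: by end_near. Qed.

(** * Comparison with exponent 1 and dependence on the horizon *)

Let K10 := fine (KL P1 P0).

Lemma K10E : K10%:E = KL P1 P0.
Proof. by rewrite /K10 -(expectation_lr_ln_lr P1_ll_P0 lrP KL01_fin KL10_fin). Qed.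

Lemma K10_gt0 : 0 < K10.
Proof. by rewrite -lte_fin K10E -g1 g_gt0//; exact: Bset1. Qed.

Lemma beta_star_cmp1 l t : 0 < t -> in_range_g P0 lr (l / t) ->
  [/\ 1 < beta_star P0 lr l t <-> t < l / K10,
      beta_star P0 lr l t = 1 <-> t = l / K10 &
      beta_star P0 lr l t < 1 <-> l / K10 < t].
Proof.
move=> t0 h; have [Bs gs] := beta_star_hits t0 h.
have K0 := K10_gt0; have B1 := Bset1; have e1 := g1; rewrite -K10E in e1.
split.
- by rewrite -(g_ltE B1 Bs) gs e1 lte_fin ltr_pdivlMr// mulrC -ltr_pdivlMr.
- split=> [s1|tl].
    have e : K10 = l / t by move: gs; rewrite s1 e1 => -[].
    have l0 : l != 0 by apply: contraTneq K0 => l0; rewrite e l0 mul0r ltxx.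
    by rewrite e; field; rewrite l0 gt_eqF.
  have l0 : l != 0 by apply: contraTneq t0 => l0; rewrite tl l0 mul0r ltxx.
  by apply: (g_inj Bs B1); rewrite gs e1 tl; congr EFin; field; rewrite l0 gt_eqF.
- by rewrite -(g_ltE Bs B1) gs e1 lte_fin ltr_pdivrMr// mulrC -ltr_pdivrMr.
Qed.

Lemma is_beta_star1 l : 0 < l -> is_beta_star P0 lr l (l / K10) 1.
Proof.
move=> l0; have K0 := K10_gt0.
apply: is_beta_starP; [exact: divr_gt0|exact: Bset1|].
by rewrite g1 -K10E; congr EFin; field; rewrite !gt_eqF.
Qed.

(** No minimiser is assumed to exist at horizon [t]. By continuity [gr b < l / t] persists slightly
    to the right of 1, and the tangent bound at such a [b] compares it with 1. *)
Lemma Bt_lt_above1 l t : 0 < t -> t < l / K10 -> (1%:E < bm)%E ->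
  exists b, [/\ B b, 1 < b & Bt P0 lr l t b < Bt P0 lr l t 1].
Proof.
move=> t0 tl bm1; have K0 := K10_gt0.
have y1 : gr 1 < l / t.
  by rewrite -lte_fin -g_gr// g1 -K10E lte_fin ltr_pdivlMr// mulrC -ltr_pdivlMr.
have near1 : \forall b \near nbhs (1 : R), gr b < l / t.
  by apply: (cvgr_lt _ (gr_continuous ltr01 bm1)).
have [c0 Bc0 c01] := lt_bmaxP bm1.
have [b [b1 bc gb]] : exists b, [/\ 1 < b, b < c0 & gr b < l / t].
  near (1 : R)^'+ => b; exists b; split; near: b.
  - exact: nbhs_right_gt.
  - exact: nbhs_right_lt.
  - exact: cvg_within.
have b0 : 0 < b by apply: lt_trans b1.
have bb := lt_bmax Bc0 bc.
exists b; split => //; first exact: Bset_lt_bmax.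
rewrite ltr_Bt//; [|exact: Bset_lt_bmax|exact: Bset1].
have := chord_sub_ge (l / t) b0 bb Bset1; rewrite -[_ < chord _ 1]subr_gt0.
apply: lt_le_trans; apply: divr_gt0; last by rewrite mulr1.
by rewrite nmulr_rgt0 ?subr_lt0.
Unshelve. all: by end_near. Qed.

(** As 1 may be [bmax], only the left slope is available: some chord ending at 1 is steeper than
    [l / t], and its starting point is the required exponent. *)
Lemma Bt_lt_below1 l t : 0 < l -> l / K10 < t ->
  exists b, [/\ B b, b < 1 & Bt P0 lr l t b < Bt P0 lr l t 1].
Proof.
move=> l0 lt; have K0 := K10_gt0.
have t0 : 0 < t by apply: lt_trans lt; exact: divr_gt0.
have : ((l / t)%:E < lslope 1)%E.
  by rewrite lslope1 -K10E lte_fin ltr_pdivrMr// mulrC -ltr_pdivrMr.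
move=> /ereal_sup_gt[_ [x /= /andP[x0 x1] <-]].
rewrite lte_fin /slope kappa1 sub0r ltr_pdivlMr ?subr_gt0// => h.
have Bx : B x := Bset_le Bset1 x0 (ltW x1).
exists x; split => //; rewrite ltr_Bt//; last exact: Bset1.
rewrite /chord kappa1 add0r divr1 ltr_pdivrMr//; lra.
Qed.

Lemma in_range_g_near l : 0 < l -> \forall t \near +oo, in_range_g P0 lr (l / t).
Proof.
move=> l0; have g0 := gr_gt0 half_gt0 half_lt_bmax.
near=> t.
have t0 : 0 < t by near: t; exact: nbhs_pinfty_gt.
apply: (in_range_g_le (divr_gt0 l0 t0) half_gt0 half_lt_bmax).
rewrite ler_pdivrMr// mulrC -ler_pdivrMr//.
Unshelve. all: by end_near. Qed.

Lemma beta_star_decreasing l s t : 0 < l -> 0 < s -> s < t ->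
  in_range_g P0 lr (l / s) -> in_range_g P0 lr (l / t) ->
  beta_star P0 lr l t < beta_star P0 lr l s.
Proof.
move=> l0 s0 st hs ht; have t0 := lt_trans s0 st.
have [Bs gs] := beta_star_hits s0 hs; have [Bt' gt] := beta_star_hits t0 ht.
by rewrite -(g_ltE Bt' Bs) gs gt lte_fin ltr_pM2l// ltf_pV2.
Qed.

(** By monotonicity of [g], the optimal exponent is below a given small [b] as soon as
    [l / t < gr b]. *)
Lemma beta_star_cvg0 l : 0 < l -> beta_star P0 lr l t @[t --> +oo] --> 0.
Proof.
move=> l0; apply/cvgrPdist_lt => e e0.
pose b := Num.min (e / 2) 2^-1.
have b0 : 0 < b by rewrite lt_min half_gt0 divr_gt0.
have be : b <= e / 2 by rewrite ge_min lexx.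
have bb : (b%:E < bm)%E.
  by apply: le_lt_trans half_lt_bmax; rewrite lee_fin ge_min lexx orbT.
have Bb := Bset_lt_bmax b0 bb.
have g0 := gr_gt0 b0 bb.
have H := in_range_g_near l0.
near=> t.
have ht : in_range_g P0 lr (l / t) by near: t.
have t0 : 0 < t by near: t; exact: nbhs_pinfty_gt.
have tb : l / gr b < t by near: t; apply: nbhs_pinfty_gt; rewrite num_real.
have [Bs gs] := beta_star_hits t0 ht.
have s0 := Bset_gt0 Bs.
have sb : beta_star P0 lr l t < b.
  by rewrite -(g_ltE Bs Bb) gs g_gr// lte_fin ltr_pdivrMr// mulrC -ltr_pdivrMr.
by rewrite sub0r normrN gtr0_norm//; lra.
Unshelve. all: by end_near. Qed.

End cumulant_generating.

(** * Products of coordinates under an i.i.d. law *)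

Import HBNNSimple.

(* The hypothesis says that the measure with density [G] has image [c * P] under [p], the conclusion is the corresponding change of variables. *)
Lemma integral_mul_comp d1 (T : measurableType d1) d2 (X : measurableType d2)
    (R : realType) (mu : {measure set T -> \bar R}) (P : {measure set X -> \bar R})
    (p : T -> X) (G : T -> R) (c : R) (h : X -> R) :
  measurable_fun setT p -> measurable_fun setT G -> (forall w, 0 <= G w) -> 0 <= c ->
  (forall A, measurable A ->
    (\int[mu]_w (G w * \1_A (p w))%:E = c%:E * P A)%E) ->
  measurable_fun setT h -> (forall x, 0 <= h x) ->
  (\int[mu]_w (G w * h (p w))%:E = c%:E * \int[P]_x (h x)%:E)%E.
Proof.
move=> mp mG G0 c0 H mh h0.
have mf : measurable_fun setT (EFin \o h) by exact/measurable_EFinP.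
have f0 : forall x, setT x -> (0 <= (EFin \o h) x)%E by move=> x _; rewrite lee_fin.
pose s := nnsfun_approx measurableT mf.
have sh x : (EFin \o s ^~ x) n @[n --> \oo] --> (h x)%:E.
  by apply: (cvg_nnsfun_approx measurableT mf f0).
have nds x : {homo s^~ x : m n / (m <= n)%N >-> m <= n}.
  by move=> m n mn; exact/lefP/nd_nnsfun_approx.
have mGs n : measurable_fun setT (fun w => G w * s n (p w)).
  by apply: measurable_funM => //; apply: measurableT_comp.
(* For a simple function both sides are finite sums over its values, and [H] applies to each level
   set. *)
have step n : (\int[mu]_w (G w * s n (p w))%:E = c%:E * \int[P]_x (s n x)%:E)%E.
  pose f r w := (G w * (r * \1_(s n @^-1` [set r]) (p w)))%:E.
  have mI r : measurable_fun setT (fun w => \1_(s n @^-1` [set r]) (p w) : R).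
    by apply: (measurableT_comp _ mp); exact: measurable_indic.
  have mf' r : measurable_fun setT (f r).
    by apply/measurable_EFinP; apply: measurable_funM => //; apply: measurable_funM.
  transitivity (\int[mu]_w (\sum_(r \in range (s n)) f r w))%E.
    apply: eq_integral => w _; rewrite fsumEFin; last exact: fimfunP.
    by rewrite [in LHS](fimfunE (s n) (p w)) mulr_fsumr.
  rewrite ge0_integral_fsum//; last first.
    move=> r w _; rewrite /f EFinM; apply: mule_ge0; first by rewrite lee_fin.
    by rewrite EFinM; exact: nnfun_muleindic_ge0.
  rewrite integralT_nnsfun sintegralE ge0_mule_fsumr; last first.
    by move=> r; exact: nnsfun_mulemu_ge0.
  apply: eq_fsbigr => r; rewrite inE => -[x _ <-].
  under eq_integral do rewrite /f mulrCA EFinM.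
  rewrite ge0_integralZl_EFin//; last 2 first.
  - by move=> w _; rewrite lee_fin mulr_ge0.
  - by apply/measurable_EFinP; apply: measurable_funM.
  by rewrite H// muleCA.
have cL : (\int[mu]_w (G w * s n (p w))%:E @[n --> \oo] --> \int[mu]_w (G w * h (p w))%:E)%E.
  have := @cvg_monotone_convergence _ _ _ mu setT measurableT (fun n w => (G w * s n (p w))%:E).
  rewrite (_ : (fun w => limn _) = (fun w => (G w * h (p w))%:E)).
    apply.
    - by move=> n; exact/measurable_EFinP.
    - by move=> n w _; rewrite lee_fin mulr_ge0.
    - by move=> w _ m n mn; rewrite lee_fin ler_wpM2l// nds.
  apply/funext => w; apply/cvg_lim => //.
  have Gw : (G w)%:E \is a fin_num by [].
  exact: (cvgeZl Gw (sh (p w))).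
have cR : (c%:E * \int[P]_x (s n x)%:E @[n --> \oo] --> c%:E * \int[P]_x (h x)%:E)%E.
  apply: cvgeZl => //.
  have := @cvg_monotone_convergence _ _ _ P setT measurableT (fun n x => (s n x)%:E).
  rewrite (_ : (fun w => limn _) = (fun x => (h x)%:E)).
    apply.
    - by move=> n; exact/measurable_EFinP.
    - by move=> n w _; rewrite lee_fin.
    - by move=> w _ m n mn; rewrite lee_fin nds.
  by apply/funext => w; apply/cvg_lim => //; exact: sh.
have cL' : (c%:E * \int[P]_x (s n x)%:E @[n --> \oo] --> \int[mu]_w (G w * h (p w))%:E)%E.
  by apply: cvg_trans cL; apply: near_eq_cvg; apply: nearW => n; rewrite step.
exact: (cvg_unique _ cL' cR).
Qed.

Section iid_law.
Context d (X : measurableType d) (R : realType) (P : probability X R)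
  (PP : probability (@path_space d X) R).
Hypothesis PP_iid : is_iid_law P PP.

Lemma measurable_coord n : measurable_fun setT (fun w : @path_space d X => w n).
Proof.
move=> _ A mA; rewrite setTI; apply: sub_sigma_algebra.
by exists n; exists A.
Qed.

Lemma measurable_prod_coord (f : nat -> X -> R) (Q : pred nat) t :
  (forall n, measurable_fun setT (f n)) ->
  measurable_fun setT (fun w : @path_space d X => \prod_(n < t | Q n) f n (w n)).
Proof.
move=> mf; have -> : (fun w : @path_space d X => \prod_(n < t | Q n) f n (w n)) =
    (fun w => \prod_(n < t) (if Q n then f n (w n) else 1)).
  by apply/funext => w; rewrite big_mkcond.
apply: measurable_prod => n _; case: (Q n) => //.
exact: measurableT_comp (mf n) (measurable_coord n).
Qed.

(* Induction on the number [k] of factors that are not indicators: one indicator at a time is replaced by a general function. *)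
Lemma integral_prod_coord (t k : nat) (f : nat -> X -> R) (e : nat -> R) :
  (forall n, measurable_fun setT (f n)) -> (forall n x, 0 <= f n x) ->
  (forall n, (\int[P]_x (f n x)%:E = (e n)%:E)%E) ->
  (forall n, (k <= n)%N -> exists2 A, measurable A & f n = \1_A) ->
  (\int[PP]_w (\prod_(n < t) f n (w n))%:E = (\prod_(n < t) e n)%:E)%E.
Proof.
elim: k f e => [|k IH] f e mf f0 fe fI.
  have /choice[A AP] : forall n, exists A, measurable A /\ f n = \1_A.
    by move=> n; have [A] := fI n (leq0n n); exists A.
  have PA n : P (A n) = (e n)%:E.
    rewrite -fe; have [mA ->] := AP n.
    by rewrite integral_indic// setIT.
  have mC : measurable ([set w | forall n, (n < t)%N -> A n (w n)] : set (@path_space d X)).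
    rewrite (_ : [set w | _] = \bigcap_(n in [set n | (n < t)%N]) [set w : @path_space d X | A n (w n)]).
      apply: bigcap_measurableType => n _.
      by rewrite -[X in measurable X]setTI; apply: measurable_coord => //; case: (AP n).
    by apply/seteqP; split => w /= h n; exact: h.
  transitivity (PP [set w : @path_space d X | forall n, (n < t)%N -> A n (w n)]).
    rewrite -[in RHS](setIT [set w | _]) -integral_indic//; apply: eq_integral => w _.
    congr EFin; rewrite indicE; case: (boolP (w \in _)) => [|/negP wn].
      rewrite inE => wA; rewrite big1// => n _; have [_ ->] := AP n.
      by rewrite indicE mem_set//; exact: wA.
    apply/eqP; rewrite prodf_seq_eq0; apply/hasP.
    have /existsNP[n /not_implyP[nt nA]] : ~ (forall n, (n < t)%N -> A n (w n)).
      by move=> h; apply: wn; rewrite inE.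
    exists (Ordinal nt); first exact: mem_index_enum.
    by have [_ ->] := AP n; rewrite /= indicE memNset.
  rewrite PP_iid; last by move=> n; case: (AP n).
  by rewrite -prodEFin; apply: eq_bigr => n _; rewrite PA.
have e0 n : 0 <= e n by rewrite -lee_fin -fe integral_ge0// => x _; rewrite lee_fin.
(* With factor [k] replaced by an indicator only the first [k] factors are general, so the induction
   hypothesis applies; the resulting identity over all [A] is the hypothesis of
   [integral_mul_comp]. *)
pose upd (T : Type) (u : T) (v : nat -> T) n := if n == k then u else v n.
have updI A : measurable A ->
    (\int[PP]_w (\prod_(n < t) upd _ (\1_A) f n (w n))%:E =
      (\prod_(n < t) upd _ (fine (P A)) e n)%:E)%E.
  move=> mA; apply: IH; rewrite /upd.
  - by move=> n; case: eqP.
  - by move=> n x; case: eqP.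
  - move=> n; case: eqP => // _.
    by rewrite integral_indic// setIT fineK// fin_num_measure.
  - move=> n kn; case: eqP => [_|/eqP nk]; first by exists A.
    by apply: fI; rewrite ltn_neqAle eq_sym nk.
(* If [t <= k], factor [k] is absent from the product and any replacement will do. *)
have [kt|tk] := ltnP k t; last first.
  have := updI setT measurableT.
  have nk (n : 'I_t) : (n == k :> nat) = false.
    by apply/negbTE; rewrite neq_ltn (leq_trans (ltn_ord n) tk).
  rewrite [in RHS](eq_bigr (fun n : 'I_t => e n)); last by move=> n _; rewrite /upd nk.
  move=> <-; apply: eq_integral => w _; congr EFin; apply: eq_bigr => n _.
  by rewrite /upd nk.
pose K := Ordinal kt.
have split_prod (u : nat -> R) : \prod_(n < t) u n = (\prod_(n < t | n != k :> nat) u n) * u k.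
  by rewrite (bigD1 K)//= mulrC.
pose G (w : @path_space d X) := \prod_(n < t | n != k :> nat) f n (w n).
pose c := \prod_(n < t | n != k :> nat) e n.
rewrite split_prod EFinM -fe.
transitivity (\int[PP]_w (G w * f k (w k))%:E)%E.
  by apply: eq_integral => w _; rewrite (split_prod (fun n => f n (w n))).
apply: (@integral_mul_comp _ _ _ _ _ PP P (fun w : @path_space d X => w k) G c (f k)) => //.
- exact: measurable_coord.
- exact: (measurable_prod_coord (fun n => n != k)).
- by move=> w; apply: prodr_ge0.
- by apply: prodr_ge0.
move=> A mA; have := updI A mA.
rewrite split_prod (eq_bigr (fun n : 'I_t => e n)); last first.
  by move=> n /negbTE nk; rewrite /upd nk.
rewrite -/c /upd eqxx EFinM fineK ?fin_num_measure// => <-.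
apply: eq_integral => w _; congr EFin.
rewrite (split_prod (fun n => (if n == k then \1_A else f n) (w n))) eqxx; congr (_ * _).
by apply: eq_bigr => n /negbTE ->.
Qed.

(** A null set in coordinate [n] is a rectangle with one null side, so its probability is a product
    with a zero factor. *)
Lemma ae_coord (Q : X -> Prop) n : {ae P, forall x, Q x} ->
  {ae PP, forall w : @path_space d X, Q (w n)}.
Proof.
move=> [N [mN N0 subN]].
exists [set w : @path_space d X | N (w n)]; split.
- by rewrite -[X in measurable X]setTI; exact: measurable_coord.
- pose A m := if m == n then N else setT.
  have mA m : measurable (A m) by rewrite /A; case: eqP.
  rewrite (_ : [set w | _] = [set w : @path_space d X | forall m, (m < n.+1)%N -> A m (w m)]).
    rewrite PP_iid// (eq_bigr (fun m : 'I_n.+1 => (fine (P (A m)))%:E)); last first.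
      by move=> m _; rewrite fineK// fin_num_measure.
    rewrite prodEFin; congr EFin; apply/eqP; rewrite prodf_seq_eq0; apply/hasP.
    by exists ord_max; rewrite ?mem_index_enum//= /A eqxx N0.
  apply/seteqP; split => w /=.
    by move=> Nw m _; rewrite /A; case: eqP => // ->.
  by move=> /(_ n (ltnSn n)); rewrite /A eqxx.
- by move=> w /= nQ; apply: subN.
Qed.

End iid_law.

(** * Type-II error *)

Section type_II_error.
Context d (X : measurableType d) (R : realType) (P0 P1 : probability X R).
Variables (lr : X -> R) (PP1 : probability (@path_space d X) R) (alpha : R).
Hypotheses (P1_ll_P0 : P1 `<< P0) (lrP : is_RNderiv P1 P0 lr)
  (KL01_fin : (KL P0 P1 < +oo)%E) (PP1_iid : is_iid_law P1 PP1)
  (alpha_gt0 : 0 < alpha).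

Local Notation l := (ln alpha^-1).

Let lr_ge0 x : 0 <= lr x. Proof. by case: lrP. Qed.
Let mlr : measurable_fun setT lr := measurable_lr lrP.

Lemma wealth_le b t (w : @path_space d X) : Bset P0 lr b ->
  (wealth P0 lr b t w <= alpha^-1) =
  (\prod_(n < t) lr (w n) <= expR (Bt P0 lr l t%:R b)).
Proof.
move=> Bb; have b0 : 0 < b by case: Bb.
have Z0 : 0 < fine (Z P0 lr b).
  rewrite (Z_expmom P1_ll_P0 lrP KL01_fin).
  by apply: (expmom0_Bset_gt0 P1_ll_P0 lrP KL01_fin).
have L0 : 0 <= \prod_(n < t) lr (w n) by apply: prodr_ge0.
have -> : wealth P0 lr b t w = (\prod_(n < t) lr (w n)) `^ b / fine (Z P0 lr b) ^+ t.
  rewrite /wealth /design big_split /=; congr (_ * _).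
    (* The induction carries nonnegativity along, which [powRM] requires of each factor. *)
    apply: (@proj2 (0 <= \prod_(n < t) lr (w n))).
    elim/big_ind2: _ => [|x y u v [y0 ->] [v0 ->]|n _]; first by rewrite powR1.
      by rewrite mulr_ge0// powRM.
    by [].
  by rewrite prodr_const card_ord exprVn.
rewrite ler_pdivrMr ?exprn_gt0//.
have -> : alpha^-1 * fine (Z P0 lr b) ^+ t = expR (Bt P0 lr l t%:R b) `^ b.
  rewrite -expRM /Bt /lambda /kappa.
  have -> : (l / b - t%:R * (- ln (fine (Z P0 lr b)) / b)) * b =
      l + ln (fine (Z P0 lr b)) * t%:R by field; rewrite gt_eqF.
  by rewrite expRD lnK ?posrE ?invr_gt0// expRM_natr lnK.
have e0 := expR_ge0 (Bt P0 lr l t%:R b).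
apply/idP/idP => [|h]; last by apply: ge0_ler_powR => //; exact: ltW.
by apply: contraLR; rewrite -!ltNge => h; exact: gt0_ltr_powR.
Qed.

Let mL t : measurable_fun setT (fun w : @path_space d X => \prod_(n < t) lr (w n)).
Proof. exact: (measurable_prod_coord (fun=> true) (f := fun=> lr)). Qed.

Lemma measurable_likelihood_le t c :
  measurable ([set w | \prod_(n < t) lr (w n) <= c] : set (@path_space d X)).
Proof.
rewrite -[X in measurable X]setTI -[X in _ `&` X]/((fun w : @path_space d X =>
  \prod_(n < t) lr (w n)) @^-1` [set y | y <= c]).
rewrite (_ : [set y | y <= c] = `]-oo, c]%classic).
  by apply: mL => //; exact: measurable_itv.
by apply/seteqP; split => y /=; rewrite in_itv.
Qed.

Lemma typeIIE b t : Bset P0 lr b -> typeII PP1 P0 lr alpha b t =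
  PP1 [set w | \prod_(n < t) lr (w n) <= expR (Bt P0 lr l t%:R b)].
Proof.
by move=> Bb; rewrite /typeII; congr (PP1 _); apply/seteqP; split => w /=; rewrite wealth_le.
Qed.

Lemma typeII_le b b' t : Bset P0 lr b -> Bset P0 lr b' ->
  Bt P0 lr l t%:R b <= Bt P0 lr l t%:R b' ->
  (typeII PP1 P0 lr alpha b t <= typeII PP1 P0 lr alpha b' t)%E.
Proof.
move=> Bb Bb' h; rewrite !typeIIE//.
apply: le_measure; rewrite ?inE; [exact: measurable_likelihood_le..|].
by move=> w /= /le_trans; apply; rewrite ler_expR.
Qed.

(* Markov's inequality for the product of the [1 / lr], whose expectation under [P1] is at most 1. *)
Lemma likelihood_le_prob t c : 0 <= c ->
  (PP1 [set w | \prod_(n < t) lr (w n) <= c]%R <= c%:E)%E.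
Proof.
move=> c0.
(* A version of [1 / lr] that is positive everywhere; where [lr] vanishes it equals 1, and the
   weight [lr] annihilates it in the change of measure. *)
pose h x := expR (- ln (lr x)).
have h0 x : 0 <= h x by exact: expR_ge0.
have mh : measurable_fun setT h.
  apply: measurableT_comp => //; apply: measurable_funN.
  exact: measurable_ln_lr lrP.
have hV x : 0 < lr x -> h x = (lr x)^-1 by move=> x0; rewrite /h expRN lnK.
have hle : (\int[P1]_x (h x)%:E <= 1)%E.
  rewrite (integral_P1 P1_ll_P0 lrP)//; last exact/measurable_EFinP.
  apply: (@le_trans _ _ (\int[P0]_x cst 1 x)%E); last first.
    by rewrite integral_cst// mul1e probability_le1.
  apply: ge0_le_integral => //.
  - by move=> x _; rewrite mule_ge0// lee_fin.
  - by apply: emeasurable_funM; exact/measurable_EFinP.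
  move=> x _; rewrite -EFinM lee_fin.
  have := lr_ge0 x; rewrite le_eqVlt => /predU1P[<-|x0]; first by rewrite mulr0.
  by rewrite hV// mulVf// gt_eqF.
have hfin : (\int[P1]_x (h x)%:E)%E \is a fin_num.
  rewrite ge0_fin_numE; first by apply: le_lt_trans hle _; exact: ltry.
  by apply: integral_ge0 => x _; rewrite lee_fin.
(* Indices from [t] on carry the indicator of the whole space, the shape expected by
   [integral_prod_coord] with [k = t]. *)
pose f n := if (n < t)%N then h else \1_setT.
pose e n : R := if (n < t)%N then fine (\int[P1]_x (h x)%:E) else 1.
have hall : (\int[PP1]_w (\prod_(n < t) h (w n))%:E <= 1)%E.
  have fE (w : @path_space d X) : \prod_(n < t) h (w n) = \prod_(n < t) f n (w n).
    by apply: eq_bigr => n _; rewrite /f ltn_ord.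
  under eq_integral do rewrite fE.
  rewrite (@integral_prod_coord _ _ _ P1 PP1 PP1_iid t t f e).
  - rewrite (eq_bigr (fun=> fine (\int[P1]_x (h x)%:E))); last first.
      by move=> n _; rewrite /e ltn_ord.
    rewrite prodr_const card_ord lee_fin exprn_ile1//; last by rewrite -lee_fin fineK.
    by apply: fine_ge0; apply: integral_ge0 => x _; rewrite lee_fin.
  - by move=> n; rewrite /f; case: ifP => // _; exact: measurable_indic.
  - by move=> n x; rewrite /f; case: ifP.
  - move=> n; rewrite /f /e; case: ifP => _; first by rewrite fineK.
    by rewrite integral_indic// setIT; exact: probability_setT.
  - by move=> n tn; exists setT => //; rewrite /f ltnNge tn.
have mE := measurable_likelihood_le t c.
have mp : measurable_fun setT (fun w : @path_space d X => \prod_(n < t) h (w n)).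
  exact: (measurable_prod_coord (fun=> true) (f := fun=> h)).
have p0 (w : @path_space d X) : 0 <= \prod_(n < t) h (w n) by apply: prodr_ge0.
rewrite -[X in PP1 X]setIT -integral_indic//.
apply: (@le_trans _ _ (\int[PP1]_w (c * \prod_(n < t) h (w n))%:E)%E); last first.
  under eq_integral do rewrite EFinM.
  rewrite ge0_integralZl_EFin//.
  - by rewrite -[leRHS]mule1 lee_wpmul2l.
  - by move=> w _; rewrite lee_fin.
  - exact/measurable_EFinP.
apply: ae_ge0_le_integral => //.
- exact/measurable_EFinP/measurable_indic.
- by move=> w _; rewrite lee_fin mulr_ge0.
- by apply/measurable_EFinP; apply: measurable_funM.
have lrpos := ae_P0_P1 P1_ll_P0 (lr_gt0_ae P1_ll_P0 lrP KL01_fin).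
have allpos : {ae PP1, forall w : @path_space d X, forall n, 0 < lr (w n)}.
  by apply/ae_foralln => n; exact: (ae_coord PP1_iid n lrpos).
apply: filterS allpos => w wpos _; rewrite lee_fin.
rewrite indicE; case: (boolP (w \in _)) => [|_]; last by rewrite mulr_ge0.
rewrite inE /= => wc.
have -> : \prod_(n < t) h (w n) = (\prod_(n < t) lr (w n))^-1.
  by rewrite -prodfV; apply: eq_bigr => n _; rewrite hV.
by rewrite ler_pdivlMr ?mul1r// prodr_gt0.
Qed.

Lemma typeII_le_expR b t : Bset P0 lr b ->
  (typeII PP1 P0 lr alpha b t <= (expR (Bt P0 lr l t%:R b))%:E)%E.
Proof. by move=> Bb; rewrite typeIIE//; exact/likelihood_le_prob/expR_ge0. Qed.

End type_II_error.

(** * Expansions at exponent 0 *)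

Lemma is_derive1_inv (R : realType) (f : R -> R) (x df : R) : f x != 0 ->
  is_derive x 1 f df -> is_derive x 1 (fun y => (f y)^-1) (- (f x) ^- 2 * df).
Proof.
move=> fx [dd dv]; apply: DeriveDef; first exact: derivableV.
by rewrite deriveV// dv.
Qed.

Lemma is_derive1_div (R : realType) (f g : R -> R) (x df dg : R) : g x != 0 ->
  is_derive x 1 f df -> is_derive x 1 g dg ->
  is_derive x 1 (fun y => f y / g y) ((df * g x - f x * dg) / g x ^+ 2).
Proof.
move=> gx hf hg; have hV := is_derive1_inv gx hg.
have := is_deriveM hf hV; move/is_derive_eq; apply.
by rewrite /GRing.scale/=; field.
Qed.

(** The extra 1 is the tolerance in the limit of the difference quotient. Applied to the tilted
    variance, it starts the remainder estimate from differentiability at the single point 0. *)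
Lemma is_derive0_lipschitz (R : realType) (f : R -> R) (df : R) :
  is_derive (0 : R) 1 f df -> exists2 r, 0 < r &
    forall x, `|x| < r -> `|f x - f 0| <= (`|df| + 1) * `|x|.
Proof.
move=> [dd dv].
have dl : (h : R)^-1 * (f (h * 1 + 0) - f 0) @[h --> (0 : R)^'] --> ('D_1 f 0 : R) := dd.
rewrite dv in dl.
move/cvgrPdist_lt : dl => /(_ 1 ltr01)[r /= r0 H].
exists r => // x xr; have [->|x0] := eqVneq x 0.
  by rewrite subrr !normr0 mulr0.
have /= := H x; rewrite sub0r normrN => /(_ xr x0).
rewrite mulr1 addr0 => h.
have -> : f x - f 0 = x * (x^-1 * (f x - f 0)) by rewrite mulVKf.
rewrite normrM mulrC ler_wpM2r//.
rewrite -[X in `|X|](subrK df) addrC (le_trans (ler_normD _ _))// lerD2l.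
by rewrite distrC ltW.
Qed.

(** The mean value theorem in place of integration: each use raises the order by one and keeps the
    constant [C]. *)
Lemma le_expr_integrate (R : realType) (F dF : R -> R) (C r : R) (n : nat) :
  0 <= C -> (forall x, 0 <= x -> x < r -> is_derive x 1 F (dF x)) -> F 0 = 0 ->
  (forall x, 0 < x -> x < r -> `|dF x| <= C * x ^+ n) ->
  forall b, 0 < b -> b < r -> `|F b| <= C * b ^+ n.+1.
Proof.
move=> C0 hF F0 hb b b0 br.
have dF' x : x \in `]0, b[ -> is_derive x 1 F (dF x).
  by rewrite in_itv/= => /andP[x0 xb]; apply: hF; [exact: ltW|exact: lt_trans br].
have cF : {within `[0, b], continuous F}.
  apply: continuous_in_subspaceT => x; rewrite inE/= in_itv/= => /andP[x0 xb].
  apply: differentiable_continuous; apply/derivable1_diffP.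
  by have [] := hF x x0 (le_lt_trans xb br).
have [c] := MVT b0 dF' cF.
rewrite in_itv/= => /andP[c0 cb]; rewrite F0 !subr0 => ->.
rewrite normrM (gtr0_norm b0) exprSr mulrA ler_wpM2r ?(ltW b0)//.
apply: le_trans (hb c c0 (lt_trans cb br)) _.
by rewrite ler_wpM2l// lerXn2r ?nnegrE ?ltW.
Qed.

Section small_exponent.
Context d (X : measurableType d) (R : realType) (P0 P1 : probability X R).
Variables (lr : X -> R) (delta : R).
Hypotheses (P1_ll_P0 : P1 `<< P0) (lrP : is_RNderiv P1 P0 lr)
  (KL01_fin : (KL P0 P1 < +oo)%E) (KL10_fin : (KL P1 P0 < +oo)%E)
  (log_nonconst : ~ exists c : R, {ae P0, forall x, ln (lr x) = c})
  (delta_gt0 : 0 < delta) (Zdelta : (Z P0 lr (- delta) < +oo)%E).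

Local Notation Y := (fun x => ln (lr x)).
Local Notation k := (kappa P0 lr).
Local Notation K01 := (fine (KL P0 P1)).
Local Notation V0 := (fine ('V_P0[Y])%E).
Let mY : measurable_fun setT Y := measurable_ln_lr lrP.
Let kE := kappa_expmom P1_ll_P0 lrP KL01_fin.
Let M := expmom P0 Y.

Let has_left : has_expmom P0 Y (- delta).
Proof. exact/(Z_has_expmom P1_ll_P0 lrP KL01_fin). Qed.

Let has_right : has_expmom P0 Y 1 := has_expmom1 P1_ll_P0 lrP KL01_fin.

Let dM j b : - delta < b -> b < 1 -> is_derive b 1 (M j) (M j.+1 b).
Proof. by move=> h1 h2; exact: (is_derive_expmom mY _ h1 h2). Qed.

Let M0_gt0 b : - delta < b -> b < 1 -> 0 < M 0 b.
Proof.
move=> h1 h2; apply: expmom0_gt0.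
exact: (has_expmom_itv mY (ltW h1) (ltW h2)).
Qed.

(** The moment of order [- delta] makes 0 an interior exponent. *)
Lemma kappa_derivable_near0 b : - delta < b -> b < 1 ->
  is_derive b 1 k (tilted_mean P0 lr b).
Proof.
move=> h1 h2; rewrite (_ : k = @ln R \o M 0); last by apply/funext => x; rewrite /= kE.
have := @is_derive1_comp _ (@ln R) (M 0) b _ _ (is_derive1_ln (M0_gt0 h1 h2)) (dM 0 h1 h2).
by move/is_derive_eq; apply; rewrite mulrC.
Qed.

Let tilted_var b := (M 2 b * M 0 b - M 1 b * M 1 b) / M 0 b ^+ 2.

Lemma tilted_mean_derivable b : - delta < b -> b < 1 ->
  is_derive b 1 (tilted_mean P0 lr) (tilted_var b).
Proof.
move=> h1 h2; apply: is_derive1_div; last exact: dM.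
- by rewrite gt_eqF// M0_gt0.
- exact: dM.
Qed.

Let int_mom j : P0.-integrable setT (EFin \o (fun x => Y x ^+ j)).
Proof.
have d0 : - delta < 0 by rewrite oppr_lt0.
have := expmom_integrable mY j d0 ltr01 has_left has_right.
by apply: eq_integrable => // x _ /=; rewrite mul0r expR0 mulr1.
Qed.

Let M_at0 j : M j 0 = \int[P0]_x (Y x ^+ j).
Proof.
transitivity (\int[P0]_x (Y x ^+ j * expR (0 * Y x))); first by [].
by apply: eq_Rintegral => x _; rewrite mul0r expR0 mulr1.
Qed.

Lemma tilted_mean0 : tilted_mean P0 lr 0 = - K01.
Proof.
rewrite /tilted_mean expmom00 divr1 -(expectation_ln_lr P1_ll_P0 lrP KL01_fin).
by rewrite -/(M 1 0) M_at0; apply: eq_Rintegral => x _; rewrite expr1.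
Qed.

Lemma tilted_var0 : tilted_var 0 = V0.
Proof.
have M00 : M 0 0 = 1 by exact: expmom00.
rewrite /tilted_var M00 expr1n mulr1 divr1.
have EY : fine ('E_P0[Y])%E = M 1 0.
  by rewrite unlock M_at0; apply: eq_Rintegral => x _; rewrite expr1.
rewrite /variance unlock EY unlock.
transitivity (\int[P0]_x ((Y x ^+ 2 - (2 * M 1 0) * Y x ^+ 1) + (M 1 0 ^+ 2) * Y x ^+ 0)).
  have i1 := integrableZl measurableT (2 * M 1 0) (int_mom 1).
  have i0 := integrableZl measurableT (M 1 0 ^+ 2) (int_mom 0).
  rewrite RintegralD//; last exact: (integrableB measurableT (int_mom 2) i1).
  rewrite RintegralB//.
  rewrite !RintegralZl//; try exact: int_mom.
  by rewrite -!M_at0 M00; ring.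
apply: eq_Rintegral => x _ /=.
rewrite expr0 expr1 mulr1 [RHS](_ : _ = (ln (lr x) - M 1 0) * (ln (lr x) - M 1 0))//.
by ring.
Qed.

Let near0 : \forall b \near (0 : R), - delta < b /\ b < 1.
Proof.
have d0 : 0 < Num.min delta 1 by rewrite lt_min delta_gt0 ltr01.
apply: filterS (nbhs0_lt d0) => b; rewrite lt_min => /andP[bd b1].
by rewrite ltrNl -normrN in bd *; split; [exact: le_lt_trans (ler_norm _) bd|exact: le_lt_trans (ler_norm _) b1].
Qed.

Lemma kappa_derivable_near : \forall b \near (0 : R), derivable k b 1.
Proof.
by apply: filterS near0 => b [h1 h2]; have [] := kappa_derivable_near0 h1 h2.
Qed.

Lemma kappa_second_derivative0 : is_derive (0 : R) 1 (derive1 k) V0.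
Proof.
rewrite -tilted_var0; apply: (@near_eq_is_derive _ _ _ (tilted_mean P0 lr)).
  apply: filterS near0 => b [h1 h2].
  by rewrite derive1E; have [_ ->] := kappa_derivable_near0 h1 h2.
by apply: tilted_mean_derivable => //; rewrite oppr_lt0.
Qed.

(** [F] and [G] are the Taylor remainders of [kappa'] and [kappa], obtained by integrating the
    linear bound on the tilted variance minus [V0] once and twice. The remainder of [gr] is
    [b * F b - G b], whence [C + C]; [r <= 1] keeps the exponents inside [Bset]. *)
Lemma kappa_expansion : exists r C : R, [/\ 0 < r, r <= 1, 0 <= C &
  forall b, 0 < b -> b < r ->
    `|k b - (- K01 * b + V0 / 2 * b ^+ 2)| <= C * b ^+ 3 /\
    `|gr P0 lr b - V0 / 2 * b ^+ 2| <= (C + C) * b ^+ 3].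
Proof.
have d0 : - delta < 0 by rewrite oppr_lt0.
have hD (x : R) : - delta < x -> x < 1 -> derivable tilted_var x 1.
  move=> h1 h2; have [dM0 dM1 dM2] := And3 (dM 0 h1 h2) (dM 1 h1 h2) (dM 2 h1 h2).
  have -> : tilted_var = (fun b => (M 2 * M 0 - M 1 * M 1) b / (M 0 * M 0) b).
    by apply/funext => b; rewrite /tilted_var expr2.
  have nz : (M 0 * M 0) x != 0 by rewrite mulf_neq0// gt_eqF// M0_gt0.
  by have [] := is_derive1_div nz (is_deriveB (is_deriveM dM2 dM0) (is_deriveM dM1 dM1))
    (is_deriveM dM0 dM0).
have [w hw] : exists w, is_derive (0 : R) 1 tilted_var w.
  by exists ('D_1 tilted_var 0); apply: DeriveDef => //; exact: hD.
have [r0 r0_gt0 Hr] := is_derive0_lipschitz hw.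
pose C := `|w| + 1; pose r := Num.min r0 1.
have C0 : 0 <= C by rewrite addr_ge0.
have r_gt0 : 0 < r by rewrite lt_min r0_gt0 ltr01.
have r1 : r <= 1 by rewrite ge_min lexx orbT.
have rr0 : r <= r0 by rewrite ge_min lexx.
have k0 : k 0 = 0 by exact: (kappa0 P1_ll_P0 lrP KL01_fin).
pose F b := tilted_mean P0 lr b + K01 - V0 * b.
pose G b := k b + K01 * b - V0 / 2 * b ^+ 2.
have dF x : 0 <= x -> x < r -> is_derive x 1 F (tilted_var x - V0).
  move=> x0 xr.
  have h := tilted_mean_derivable (lt_le_trans d0 x0) (lt_le_trans xr r1).
  have := is_deriveB (is_deriveD h (is_derive_cst K01 x 1)) (is_deriveZ V0 (is_derive_id x 1)).
  by move/is_derive_eq; apply; rewrite addr0 /GRing.scale/= mulr1.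
have dG x : 0 <= x -> x < r -> is_derive x 1 G (F x).
  move=> x0 xr.
  have h := kappa_derivable_near0 (lt_le_trans d0 x0) (lt_le_trans xr r1).
  have := is_deriveB (is_deriveD h (is_deriveZ K01 (is_derive_id x 1)))
    (is_deriveZ (V0 / 2) (is_deriveX 2 (is_derive_id x 1))).
  by move/is_derive_eq; apply; rewrite /F /GRing.scale/= !mulr1 expr1; field.
have F0 : F 0 = 0 by rewrite /F tilted_mean0 mulr0 subr0 addNr.
have G0 : G 0 = 0 by rewrite /G k0 mulr0 expr0n/= mulr0 subr0 addr0.
have bF b : 0 < b -> b < r -> `|F b| <= C * b ^+ 2.
  apply: (le_expr_integrate C0 dF F0) => x x0 xr.
  by have := Hr x; rewrite gtr0_norm// tilted_var0 expr1; apply; exact: lt_le_trans rr0.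
have bG b : 0 < b -> b < r -> `|G b| <= C * b ^+ 3.
  by apply: (le_expr_integrate C0 dG G0) => x x0 xr; exact: bF.
exists r, C; split => // b b0 br; split.
  by rewrite (_ : _ - _ = G b) ?bG// /G; ring.
rewrite (_ : _ - _ = b * F b - G b); last by rewrite /gr /F /G; field.
rewrite (le_trans (ler_normB _ _))// mulrDl lerD//; last exact: bG.
by rewrite normrM gtr0_norm// exprS mulrCA ler_pM2l//; exact: bF.
Qed.

Lemma lambda_expansion : exists C : R, \forall b \near (0 : R)^'+,
  `|lambda P0 lr b - (K01 - V0 / 2 * b)| <= C * b ^+ 2.
Proof.
have [r [C [r0 _ C0 H]]] := kappa_expansion.
exists C; near=> b.
have b0 : 0 < b by [].
have br : b < r by near: b; exact: nbhs_right_lt.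
have [h _] := H b b0 br.
rewrite (_ : _ - _ = - (k b - (- K01 * b + V0 / 2 * b ^+ 2)) / b); last first.
  by rewrite /lambda; field; rewrite gt_eqF.
rewrite normrM normrN normfV (gtr0_norm b0) ler_pdivrMr//.
by rewrite -[leRHS]mulrA -exprSr.
Unshelve. all: by end_near. Qed.

(** * The optimal exponent and its wealth threshold at large horizons *)

Section asymptotics.
Variable l : R.
Hypotheses (l_gt0 : 0 < l) (V0_gt0 : 0 < V0).

Local Notation bs := (beta_star P0 lr l).

(** Positive root of [V0 / 2 * s ^ 2 = l / t], the equation [g b = l / t] at leading order. *)
Let s (t : R) : R := Num.sqrt (2 * l / (t * V0)).

Let s_gt0 t : 0 < t -> 0 < s t.
Proof. by move=> t0; rewrite sqrtr_gt0 divr_gt0 ?mulr_gt0. Qed.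

Let s_sqr t : 0 < t -> s t ^+ 2 = 2 * l / (t * V0).
Proof. by move=> t0; rewrite sqr_sqrtr// divr_ge0 ?mulr_ge0// ltW. Qed.

Lemma beta_star_nat_cvg0 : bs n%:R @[n --> \oo] --> 0.
Proof.
have := beta_star_cvg0 P1_ll_P0 lrP KL01_fin log_nonconst l_gt0.
by apply: cvg_comp; exact: cvgr_idn.
Qed.

Lemma near_nat_hits : \forall n \near \oo, 0 < (n%:R : R) /\ in_range_g P0 lr (l / n%:R).
Proof.
have H := in_range_g_near P1_ll_P0 lrP KL01_fin log_nonconst l_gt0.
have Hn := cvgr_idn H.
have H0 := @nbhs_pinfty_gt R 0 (num_real 0); have Hn0 := cvgr_idn H0.
by near=> n; split; near: n; [exact: Hn0|exact: Hn].
Unshelve. all: by end_near. Qed.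

Lemma beta_star_ratio_cvg : s n%:R / bs n%:R @[n --> \oo] --> (1 : R).
Proof.
have [r [C [r0 r1 C0 H]]] := kappa_expansion.
(* The remainder [(C + C) * x ^ 3] of [gr], divided by [V0 / 2 * x ^ 2], is [D * x]. *)
pose D := 4 * C / V0.
have cD : D * bs n%:R @[n --> \oo] --> 0.
  by rewrite -(mulr0 D); apply: cvgMl_tmp; exact: beta_star_nat_cvg0.
apply/cvgrPdist_lt => e e0; near=> n.
have De : D * bs n%:R < e by near: n; exact: (cvgr_lt _ cD).
have xr : bs n%:R < r by near: n; exact: (cvgr_lt _ beta_star_nat_cvg0).
have [n0 hn] : 0 < (n%:R : R) /\ in_range_g P0 lr (l / n%:R) by near: n; exact: near_nat_hits.
have [Bx gx] := beta_star_hits P1_ll_P0 lrP KL01_fin log_nonconst n0 hn.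
set x := bs n%:R in De xr Bx gx *.
have x0 : 0 < x by case: Bx.
have xb : (x%:E < bmax P0 lr)%E.
  have B1 := Bset1 P1_ll_P0 lrP KL01_fin.
  exact: (lt_bmax B1 (lt_le_trans xr r1)).
have gE : gr P0 lr x = l / n%:R.
  by move: gx; rewrite (g_gr P1_ll_P0 lrP KL01_fin log_nonconst x0 xb) => -[].
have [_ hg] := H x x0 xr; rewrite gE in hg.
have sx0 : 0 <= s n%:R / x by rewrite divr_ge0// ltW// s_gt0.
have e1 : (s n%:R / x) ^+ 2 - 1 = 2 / (V0 * x ^+ 2) * (l / n%:R - V0 / 2 * x ^+ 2).
  by rewrite expr_div_n s_sqr//; field; rewrite !gt_eqF.
have h1 : `|(s n%:R / x) ^+ 2 - 1| <= D * x.
  rewrite e1 normrM gtr0_norm ?divr_gt0 ?mulr_gt0 ?exprn_gt0//.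
  rewrite (_ : D * x = 2 / (V0 * x ^+ 2) * ((C + C) * x ^+ 3)); last first.
    by rewrite /D; field; rewrite !gt_eqF.
  by rewrite ler_pM2l// divr_gt0 ?mulr_gt0 ?exprn_gt0.
(* For [q >= 0], [|q - 1| <= |q ^ 2 - 1|] because [q + 1 >= 1]; this removes the square without a
   square root. *)
rewrite distrC; apply: le_lt_trans De; apply: le_trans h1.
rewrite -[X in _ ^+ 2 - X](expr1n _ 2) subr_sqr normrM ler_peMr//.
by rewrite ger0_norm ?addr_ge0// lerDr.
Unshelve. all: by end_near. Qed.

Lemma beta_star_asymptotics : exists2 eps : R^nat, eps n @[n --> \oo] --> 0 &
  \forall t \near \oo, bs t%:R = Num.sqrt (2 * l / (t%:R * V0)) * (1 + eps t).
Proof.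
exists (fun n => (s n%:R / bs n%:R)^-1 - 1).
  rewrite -(subrr (1 : R)); apply: cvgB; last exact: cvg_cst.
  rewrite -[X in _ --> X]invr1; apply: cvgV; first exact: oner_neq0.
  exact: beta_star_ratio_cvg.
apply: filterS near_nat_hits => n [n0 _].
have := s_gt0 n0; rewrite -/(s n%:R) => sn.
by rewrite addrC subrK invf_div mulrC divfK// gt_eqF.
Qed.

(** Minimality allows comparison with the explicit exponent [s n], so no rate of convergence of the
    optimal exponent enters. *)
Lemma Bt_beta_star_le : exists C : R, \forall t \near \oo,
  Bset P0 lr (bs t%:R) /\
  Bt P0 lr l t%:R (bs t%:R) <= - t%:R * K01 + Num.sqrt (2 * l * t%:R * V0) + C.
Proof.
have [r [C [r0 r1 C0 H]]] := kappa_expansion.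
(* The cubic remainder contributes [n / x * (C * x ^ 3) = n * C * x ^ 2], which is constant in [n]
   at [x = s n]. *)
exists (2 * l * C / V0); near=> n.
have [n0 hn] : 0 < (n%:R : R) /\ in_range_g P0 lr (l / n%:R) by near: n; exact: near_nat_hits.
have nr : 2 * l / (r ^+ 2 * V0) < n%:R.
  by near: n; exact: nbhs_infty_gtr.
have [Bx gx] := beta_star_hits P1_ll_P0 lrP KL01_fin log_nonconst n0 hn.
split => //.
have [x [ex x0]] : exists x, x = s n%:R /\ 0 < x by exists (s n%:R); split => //; exact: s_gt0.
have x2 : x ^+ 2 = 2 * l / (n%:R * V0) by rewrite ex s_sqr.
have xr : x < r.
  rewrite -(ltr_pXn2r (n := 2))// ?nnegrE ?ltW// x2 ltr_pdivrMr ?mulr_gt0//.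
  move: nr; rewrite ltr_pdivrMr ?mulr_gt0 ?exprn_gt0//.
  by rewrite mulrCA.
have B1 := Bset1 P1_ll_P0 lrP KL01_fin.
have Bx' : Bset P0 lr x.
  by apply: (Bset_le P1_ll_P0 lrP KL01_fin B1 x0); rewrite ltW// (lt_le_trans xr).
have : Bt P0 lr l n%:R (bs n%:R) <= Bt P0 lr l n%:R x.
  have [_ _ hmin] := is_beta_starP P1_ll_P0 lrP KL01_fin log_nonconst n0 Bx gx.
  by have [->|xb] := eqVneq x (bs n%:R); [exact: lexx|exact/ltW/hmin].
move=> h; apply: (le_trans h).
have [hk _] := H x x0 xr.
have sq : Num.sqrt (2 * l * n%:R * V0) = n%:R * V0 * x.
  rewrite -[RHS]ger0_norm; last by rewrite !mulr_ge0// ltW.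
  rewrite -sqrtr_sqr; congr Num.sqrt; rewrite exprMn x2; field.
  by rewrite !gt_eqF.
have lE : l = n%:R * V0 * x ^+ 2 / 2 by rewrite x2; field; rewrite !gt_eqF.
have k1 : k x <= - K01 * x + V0 / 2 * x ^+ 2 + C * x ^+ 3.
  by rewrite -lerBlDl; apply: le_trans (ler_norm _) hk.
rewrite sq.
have -> : 2 * l * C / V0 = n%:R * C * x ^+ 2 by rewrite x2; field; rewrite !gt_eqF.
have -> : Bt P0 lr l n%:R x = n%:R * V0 * x / 2 + n%:R / x * k x.
  by rewrite /Bt /lambda {1}lE; field; rewrite gt_eqF.
have -> : - n%:R * K01 + n%:R * V0 * x + n%:R * C * x ^+ 2 =
    n%:R * V0 * x / 2 + n%:R / x * (- K01 * x + V0 / 2 * x ^+ 2 + C * x ^+ 3).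
  by field; rewrite gt_eqF.
by rewrite lerD2l ler_pM2l// divr_gt0.
Unshelve. all: by end_near. Qed.

End asymptotics.

End small_exponent.
Theorem theorem5p6 (d : measure_display) (X : measurableType d) (R : realType)
    (P0 P1 : probability X R) (lr : X -> R)
    (PP1 : probability (@path_space d X) R) (alpha : R)
    (P1_ll_P0 : P1 `<< P0)
    (lr_dP1_dP0 : is_RNderiv P1 P0 lr)
    (KL01_fin : (KL P0 P1 < +oo)%E)
    (KL10_fin : (KL P1 P0 < +oo)%E)
    (log_nonconst : ~ exists c : R, {ae P0, forall x, ln (lr x) = c})
    (PP1_iid : is_iid_law P1 PP1)
    (alpha_gt0 : 0 < alpha) (alpha_lt1 : alpha < 1) :
  let l := ln alpha^-1 in
  let B := Bset P0 lr in
  let kappa := kappa P0 lr in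
  let lambda := lambda P0 lr in
  let g := g P0 lr in
  let Bt := Bt P0 lr l in
  let bmax := bmax P0 lr in
  let bs := beta_star P0 lr l in
  let hits (t : R) := in_range_g P0 lr (l / t) in
  let gamma t b := typeII PP1 P0 lr alpha b t in
  let K10 := fine (KL P1 P0) in
  let K01 := fine (KL P0 P1) in
  let V0 := fine ('V_P0[fun x => ln (lr x)])%E in
  ((forall b, B b -> (b%:E < bmax)%E -> derivable kappa b 1) /\
   (forall b, B b -> b%:E = bmax -> cvg (dquot P0 lr b x @[x --> b^'-])))
  /\
  [/\ forall b b', B b -> B b' -> b < b' -> (g b < g b')%E,
      g b @[b --> 0^'+] --> (0 : \bar R)%E &
      g 1 = KL P1 P0]
  /\
  (forall t : nat, (0 < t)%N -> hits t%:R ->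
    [/\ B (bs t%:R),
        forall b b', B b -> b < b' -> b' <= bs t%:R ->
          Bt t%:R b' < Bt t%:R b,
        forall b b', bs t%:R <= b -> b < b' -> B b' ->
          Bt t%:R b < Bt t%:R b',
        forall b, B b -> b != bs t%:R -> Bt t%:R (bs t%:R) < Bt t%:R b &
        forall b, B b -> (g b = (l / t%:R)%:E <-> b = bs t%:R)])
  /\
  (forall t : nat, (0 < t)%N -> ~ hits t%:R ->
    (forall b b', B b -> B b' -> b < b' -> Bt t%:R b' < Bt t%:R b) /\
    (Bt t%:R (fine y))%:E @[y --> within [set y | (y < bmax)%E] (nbhs bmax)]
      --> ereal_inf [set (Bt t%:R b)%:E | b in B])
  /\
  (forall (t : nat) (b : R), (0 < t)%N -> B b ->
    (forall b', B b' -> Bt t%:R b <= Bt t%:R b') ->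
    forall b', B b' -> (gamma t b <= gamma t b')%E)
  /\
  [/\ forall t : R, 0 < t -> hits t ->
        [/\ 1 < bs t <-> t < l / K10,
            bs t = 1 <-> t = l / K10 &
            bs t < 1 <-> l / K10 < t],
      (forall x, design P0 lr 1 x = lr x) /\ is_beta_star P0 lr l (l / K10) 1,
      forall t : R, 0 < t -> t < l / K10 -> (1%:E < bmax)%E ->
        exists b, [/\ B b, 1 < b & Bt t b < Bt t 1],
      forall t : R, l / K10 < t ->
        exists b, [/\ B b, b < 1 & Bt t b < Bt t 1] &
      [/\ \forall t \near +oo, hits t,
          forall s t : R, 0 < s -> s < t -> hits s -> hits t -> bs t < bs s &
          bs t @[t --> +oo] --> 0]]
  /\
  (forall delta : R, 0 < delta -> (Z P0 lr (- delta) < +oo)%E ->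
    (0 < 'V_P0[fun x => ln (lr x)])%E ->
    ('V_P0[fun x => ln (lr x)] < +oo)%E ->
    [/\ (\forall b \near (0 : R), derivable kappa b 1) /\
          is_derive (0 : R) 1 (derive1 kappa) V0,
        exists C : R, \forall b \near (0 : R)^'+,
          `|lambda b - (K01 - V0 / 2 * b)| <= C * b ^+ 2,
        exists2 eps : R^nat, eps n @[n --> \oo] --> 0 &
          \forall t \near \oo,
            bs t%:R = Num.sqrt (2 * l / (t%:R * V0)) * (1 + eps t) &
        exists C : R, \forall t \near \oo,
          (gamma t (bs t%:R) <=
            (expR (- t%:R * K01 + Num.sqrt (2 * l * t%:R * V0) + C))%:E)%E]).
Proof.
move=> l B k lam gg BB bm bs hits gamma K10 K01 V0.
have a1 : 1 < alpha^-1 by rewrite invf_gt1.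
have l0 : 0 < l by rewrite ln_gt0.
split; [split|split; [split|split; [|split; [|split; [|split]]]]].
- move=> b Bb bb.
  by have [] := kappa_derivable P1_ll_P0 lr_dP1_dP0 KL01_fin (Bset_gt0 Bb) bb.
- move=> b Bb _; apply/cvg_ex; eexists.
  exact: (dquot_cvg P1_ll_P0 lr_dP1_dP0 KL01_fin log_nonconst Bb).
- exact: (g_strictly_increasing P1_ll_P0 lr_dP1_dP0 KL01_fin log_nonconst).
- exact: (g_cvg0 P1_ll_P0 lr_dP1_dP0 KL01_fin log_nonconst).
- exact: (g1 P1_ll_P0 lr_dP1_dP0 KL01_fin KL10_fin log_nonconst).
- move=> t t0 ht; have tr0 : 0 < (t%:R : R) by rewrite ltr0n.
  have [Bs gs] := beta_star_hits P1_ll_P0 lr_dP1_dP0 KL01_fin log_nonconst tr0 ht.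
  have s0 := Bset_gt0 Bs.
  split => //.
  + move=> b b' Bb bb' b's.
    have Bb' : Bset P0 lr b'.
      exact: (Bset_le P1_ll_P0 lr_dP1_dP0 KL01_fin Bs (lt_trans (Bset_gt0 Bb) bb') b's).
    rewrite ltr_Bt//.
    exact: (chord_decreasing P1_ll_P0 lr_dP1_dP0 KL01_fin log_nonconst Bs gs Bb bb' b's).
  + move=> b b' sb bb' Bb'.
    have Bb : Bset P0 lr b.
      exact: (Bset_le P1_ll_P0 lr_dP1_dP0 KL01_fin Bb' (lt_le_trans s0 sb) (ltW bb')).
    rewrite ltr_Bt//.
    exact: (chord_increasing P1_ll_P0 lr_dP1_dP0 KL01_fin log_nonconst Bs gs sb bb' Bb').
  + move=> b Bb bs'; rewrite ltr_Bt//.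
    exact: (chord_min P1_ll_P0 lr_dP1_dP0 KL01_fin log_nonconst Bs gs Bb bs').
  + move=> b Bb; split=> [gb|->//].
    exact/esym/(beta_starE P1_ll_P0 lr_dP1_dP0 KL01_fin log_nonconst tr0 Bb gb).
- move=> t t0 ht; have tr0 : 0 < (t%:R : R) by rewrite ltr0n.
  split=> [b b' Bb Bb' bb'|].
    exact: (Bt_decreasing_not_hits P1_ll_P0 lr_dP1_dP0 KL01_fin log_nonconst l0 tr0 ht Bb Bb' bb').
  exact: (Bt_cvg_bmax P1_ll_P0 lr_dP1_dP0 KL01_fin log_nonconst l0 tr0 ht).
- move=> t b t0 Bb hb b' Bb'.
  exact: (typeII_le PP1 P1_ll_P0 lr_dP1_dP0 KL01_fin alpha_gt0 Bb Bb' (hb _ Bb')).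
- split.
  + by move=> t t0 ht; exact: (beta_star_cmp1 P1_ll_P0 lr_dP1_dP0 KL01_fin KL10_fin log_nonconst t0 ht).
  + split=> [x|].
      have [_ lr0 _] := lr_dP1_dP0.
      by rewrite /design powRr1// (Z1 P1_ll_P0 lr_dP1_dP0 KL01_fin) divr1.
    exact: (is_beta_star1 P1_ll_P0 lr_dP1_dP0 KL01_fin KL10_fin log_nonconst l0).
  + move=> t t0 tl b1.
    exact: (Bt_lt_above1 P1_ll_P0 lr_dP1_dP0 KL01_fin KL10_fin log_nonconst t0 tl b1).
  + move=> t tl.
    exact: (Bt_lt_below1 P1_ll_P0 lr_dP1_dP0 KL01_fin KL10_fin log_nonconst l0 tl).
  + split.
    * exact: (in_range_g_near P1_ll_P0 lr_dP1_dP0 KL01_fin log_nonconst l0).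
    * move=> s t s0 st hs ht.
      exact: (beta_star_decreasing P1_ll_P0 lr_dP1_dP0 KL01_fin log_nonconst l0 s0 st hs ht).
    * exact: (beta_star_cvg0 P1_ll_P0 lr_dP1_dP0 KL01_fin log_nonconst l0).
- move=> delta delta0 Zd Vgt0 Vfin.
  have V0_gt0 : 0 < V0 by rewrite fine_gt0// Vgt0.
  split.
  + split.
      exact: (kappa_derivable_near P1_ll_P0 lr_dP1_dP0 KL01_fin delta0 Zd).
    exact: (kappa_second_derivative0 P1_ll_P0 lr_dP1_dP0 KL01_fin delta0 Zd).
  + exact: (lambda_expansion P1_ll_P0 lr_dP1_dP0 KL01_fin delta0 Zd).
  + exact: (beta_star_asymptotics P1_ll_P0 lr_dP1_dP0 KL01_fin log_nonconst delta0 Zd l0 V0_gt0).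
  + have [C HC] := Bt_beta_star_le P1_ll_P0 lr_dP1_dP0 KL01_fin log_nonconst delta0 Zd l0 V0_gt0.
    exists C; apply: filterS HC => t [Bs hB].
    apply: le_trans (typeII_le_expR P1_ll_P0 lr_dP1_dP0 KL01_fin PP1_iid alpha_gt0 t Bs) _.
    by rewrite lee_fin ler_expR.
Qed.
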